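(* Let $\mathcal H$ be a well-structured preconditioner set, $\epsilon>0$, $\beta\in(0,1]$, $\eta>0$, $T\in\mathbb N$. Let $f:\mathbb R^d\to\mathbb R$ be twice continuously differentiable, bounded below, with $\Lambda_{\mathcal H}(f)<\infty$, and let $\Delta_0=f(x_0)-\inf_x f(x)$. Let $f_0,\dots,f_{T-1}$ be mutually independent random differentiable functions and $\Sigma\in\mathcal S_+^d$ such that for all $t$ and all $x$: $\mathbb E[\nabla f_t(x)]=\nabla f(x)$ and almost surely $-\Sigma\preceq\nabla f(x)\nabla f(x)^\top-\nabla f_t(x)\nabla f_t(x)^\top\preceq\Sigma$. Let $(x_t)$, $(V_t)$ be generated by the weighted adaptive algorithm. Then $$\mathbb E\Big[\frac1T\sum_{t=0}^{T-1}\|\nabla f(x_t)\|_{\mathcal H,*}\Big]\le\frac{\sqrt{\sum_{i=0}^{T-1}\beta^{i/2}}}{T}\,\xi+\frac{\sqrt{\operatorname{Tr}\big[P_{\mathcal H}\big((\sum_{i=0}^{T-1}\beta^i)\Sigma+\epsilon I_d\big)\big]}}{\sqrt T}\sqrt{\xi},$$ where $\xi=\frac{2\Delta_0}{\eta}+\eta\Lambda_{\mathcal H}(f)\|S_T\|_{\mathrm{op}}+\sqrt2\,d\,\|\Sigma\|_{\mathrm{op}}^{1/2}\|S_T\|_{\mathrm{op}}$ and $S_T=\mathbb E\sum_{t=0}^{T-1}V_t^{-1}(V_t^2-\beta V_{t-1}^2)V_t^{-1}$ with $V_{-1}:=\sqrt\epsilon I_d$.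
   Context: $\mathcal S^d_+$ (resp. $\mathcal S^d_{++}$) denotes the set of real symmetric positive semidefinite (resp. positive definite) $d\times d$ matrices; $\langle A,B\rangle=\operatorname{Tr}(A^\top B)$. A set $\mathcal H\subseteq\mathcal S_+^d$ is a well-structured preconditioner set if $\mathcal H=\mathcal S_+^d\cap\mathcal K$ for some set $\mathcal K$ of real $d\times d$ matrices that is closed under scalar multiplication, matrix addition and matrix multiplication and contains the identity $I_d$. For $M\in\mathcal S^d_{++}$, $P_{\mathcal H}(M):=\arg\min_{H\in\mathcal H\cap\mathcal S^d_{++}}\langle M,H^{-1}\rangle+\operatorname{Tr}(H)$ (the minimizer exists and is unique); for singular $M\in\mathcal S^d_+$, $P_{\mathcal H}(M):=\lim_{\delta\downarrow0}P_{\mathcal H}(M+\delta I_d)$. For $H\in\mathcal S_+^d$, $\|x\|_H=\sqrt{x^\top Hx}$; $\|x\|_{\mathcal H}:=\sup_{H\in\mathcal H,\operatorname{Tr}(H)\le 1}\|x\|_H$ and $\|y\|_{\mathcal H,*}:=\sup_{\|x\|_{\mathcal H}\le 1}\langle x,y\rangle$. The adaptive smoothness is $\Lambda_{\mathcal H}(f):=\inf\{\operatorname{Tr}(H): H\in\mathcal H,\ -H\preceq\nabla^2 f(x)\preceq H\ \text{for all }x\}$. Weighted adaptive algorithm: given $x_0\in\mathbb R^d$, set $M_{-1}=0$ and for $t=0,\dots,T-1$: $g_t=\nabla f_t(x_t)$, $M_t=\beta M_{t-1}+g_tg_t^\top$, $V_t=P_{\mathcal H}(M_t+\epsilon I_d)$,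 $x_{t+1}=x_t-\eta V_t^{-1}g_t$. *)

(* Defs.v *)
From HB Require Import structures.
From mathcomp Require Import all_boot all_order all_algebra.
From mathcomp Require Import all_classical all_reals all_analysis.
Set Implicit Arguments. Unset Strict Implicit. Unset Printing Implicit Defensive.
Import Order.TTheory GRing.Theory Num.Theory.
Import numFieldNormedType.Exports.
Local Open Scope classical_set_scope.
Local Open Scope ring_scope.

Section Defs.
Variable R : realType.
Variable d : nat.
Local Notation vec := 'rV[R]_d.
Local Notation mat := 'M[R]_d.

Definition qform (A : mat) (x : vec) : R := (x *m A *m x^T) 0 0.

Definition psd (A : mat) : Prop := A^T = A /\ forall x : vec, 0 <= qform A x.
Definition pd (A : mat) : Prop := A^T = A /\ forall x : vec, x != 0 -> 0 < qform A x.

Definition loewner (A B : mat) : Prop := psd (B - A).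

Definition frob (A B : mat) : R := \tr (A^T *m B).

Definition well_structured (H : set mat) : Prop :=
  exists K : set mat,
    [/\ (forall (a : R) A, K A -> K (a *: A)),
        (forall A B, K A -> K B -> K (A + B)),
        (forall A B, K A -> K B -> K (A *m B)),
        K 1%:M &
        H = psd `&` K].

Definition is_PH (H : set mat) (M V : mat) : Prop :=
  [/\ H V, pd V &
      forall W, H W -> pd W ->
        frob M (invmx V) + \tr V <= frob M (invmx W) + \tr W].

(* P_H(M) (used only for positive definite M, where the minimizer exists
   and is unique) *)
Definition PH (H : set mat) (M : mat) : mat := xget 0 (is_PH H M).

Definition Anorm (A : mat) (x : vec) : R := Num.sqrt (qform A x).

Definition Hnorm (H : set mat) (x : vec) : R :=
  sup [set Anorm A x | A in [set A | H A /\ \tr A <= 1]].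

Definition Hdualnorm (H : set mat) (y : vec) : R :=
  sup [set (x *m y^T) 0 0 | x in [set x | Hnorm H x <= 1]].

Definition norm2 (x : vec) : R := Num.sqrt (\sum_i x 0 i ^+ 2).
Definition opnorm (A : mat) : R :=
  sup [set norm2 (x *m A) | x in [set x | norm2 x <= 1]].

Definition partial (i : 'I_d) (g : vec -> R) (x : vec) : R :=
  'D_(delta_mx 0 i) g x.
Definition grad (g : vec -> R) (x : vec) : vec := \row_i partial i g x.
Definition hessian (g : vec -> R) (x : vec) : mat :=
  \matrix_(i, j) partial j (partial i g) x.

Definition C2 (g : vec -> R) : Prop :=
  [/\ (forall x, differentiable g x),
      (forall i x, differentiable (partial i g) x) &
      (forall i j, continuous (partial j (partial i g)))].

Definition adaptive_smoothness (H : set mat) (g : vec -> R) : R :=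
  inf [set \tr A | A in [set A | H A /\
        forall x, loewner (- A) (hessian g x) /\ loewner (hessian g x) A]].
Definition adaptive_smoothness_finite (H : set mat) (g : vec -> R) : Prop :=
  exists A, H A /\ forall x, loewner (- A) (hessian g x) /\ loewner (hessian g x) A.

(* Weighted adaptive algorithm driven by the gradient oracle G t x
   (= grad f_t (x)). State at step t: (x_t, M_{t-1}), with M_{-1} = 0. *)
Fixpoint ada_state (H : set mat) (eps beta eta : R) (x0 : vec)
    (G : nat -> vec -> vec) (t : nat) : vec * mat :=
  match t with
  | 0 => (x0, 0)
  | t'.+1 =>
      let: (x, Mp) := ada_state H eps beta eta x0 G t' in
      let g := G t' x in
      let M := beta *: Mp + g^T *m g in
      let V := PH H (M + eps%:M) in
      (x - eta *: (g *m invmx V), M)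
  end.

Definition ada_x H eps beta eta x0 G t : vec :=
  (ada_state H eps beta eta x0 G t).1.
Definition ada_M H eps beta eta x0 G t : mat :=
  let g := G t (ada_x H eps beta eta x0 G t) in
  beta *: (ada_state H eps beta eta x0 G t).2 + g^T *m g.
Definition ada_V H eps beta eta x0 G t : mat :=
  PH H (ada_M H eps beta eta x0 G t + eps%:M).
(* V_{t-1}^2, with V_{-1} := sqrt(eps) I, i.e. V_{-1}^2 = eps I *)
Definition ada_Vprev_sq H eps beta eta x0 G t : mat :=
  if t is t'.+1 then ada_V H eps beta eta x0 G t' *m ada_V H eps beta eta x0 G t'
  else eps%:M.
Definition ada_S_term H eps beta eta x0 G t : mat :=
  let V := ada_V H eps beta eta x0 G t in
  invmx V *m (V *m V - beta *: ada_Vprev_sq H eps beta eta x0 G t) *m invmx V.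

End Defs.

Section Prob.
Context {R : realType} {dd : measure_display} {Omega : measurableType dd}.

Definition rfun_sigma {X : Type} (F : Omega -> X -> R) : set (set Omega) :=
  <<s [set E | exists x B, measurable B /\ E = (fun w => F w x) @^-1` B] >>.

Definition mutually_independent (P : probability Omega R)
    (S : nat -> set (set Omega)) (T : nat) : Prop :=
  forall (A : nat -> set Omega), (forall t, (t < T)%N -> S t (A t)) ->
  forall s : seq nat, uniq s -> all (fun t => (t < T)%N) s ->
    P (\big[setI/setT]_(t <- s) A t) = (\prod_(t <- s) P (A t))%E.

End Prob.

(* Main.v *)
(* For a well-structured set, [V = PH H M] is the positive definite element of the
   algebra [K] whose square is the orthogonal projection of [M] on the symmetric part
   of [K].  Hence [V] is monotone and (1/2)-Hoelder in [M].

   Let [W_t] be the preconditioner obtained from [V_t] by replacing [g_t g_t^T] with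
   [grad f grad f^T + Sigma].  It is determined by the past and dominates [V_t], and
   [W_t - V_t <= sqrt (2 |Sigma|)].  In the descent lemma, trading [V_t^-1] for
   [W_t^-1] costs half of [r_t = |grad f(x_t)|^2] in the norm of [W_t^-1] and a multiple
   of [Tr S].  Since [W_t] is independent of [f_t], [g_t] may then be averaged, so
   that [E (sum_t r_t) <= xi].

   Pathwise, [|grad f(x_t)|_* <= sqrt (Tr W_t * r_t)].  The trace of the square root of
   a projected matrix behaves like a nuclear norm: discounting the past by [beta]
   multiplies the trace in excess of the noise level
   [p = Tr PH ((sum beta^i) Sigma + eps)] by at most [sqrt beta], whence
   [sum_t Tr W_t <= (sum_i beta^(i/2)) * sum_t r_t + T p].  Cauchy-Schwarz over [t]
   and Jensen's inequality for the square root conclude. *)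

Require Import Defs.
From HB Require Import structures.
From mathcomp Require Import all_boot all_order all_algebra.
From mathcomp Require Import all_classical all_reals all_analysis.
From mathcomp Require Import measurable_realfun.
From mathcomp Require Import ring lra.
Set Implicit Arguments. Unset Strict Implicit. Unset Printing Implicit Defensive.
Import Order.TTheory GRing.Theory Num.Theory.
Import numFieldNormedType.Exports.
Local Open Scope classical_set_scope.
Local Open Scope ring_scope.

(** * Quadratic forms and the spectral theorem *)

(** The obstacle is that [V_t] depends on [g_t], so the mean of [g_t V_t^-1] does not factor. Both
    halves of the noise bound serve to replace [V_t]: one gives [V_t <= W_t], the other, added to
    the [Sigma] already put into [W_t], gives [W_t^2 <= V_t^2 + 2 |Sigma| I], the origin of
    [sqrt 2]. The factor [d] in [xi] is [Tr I], from [Tr S <= d |S|].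

    [K] is only an algebra, perhaps not stable under transposition. It does contain every function
    of its symmetric elements, since on a finite spectrum a function is a polynomial. Hence
    inverses, square roots and spectral projectors of such elements may be tested against the
    projection.

    The noise hypothesis is almost sure at each fixed point, whereas the iterates are random.
    Independence allows the iterate to be frozen, and countably many test vectors keep the
    exceptional set null. Apart from the integrability of [S], which is assumed, integrability comes
    from [|g_t V_t^-1|^2 <= d], valid for every gradient: each [x_t] stays in a deterministic box,
    on which [grad f] is bounded. *)

Section BilinearForms.
Context {R : realType} {d : nat}.
Implicit Types (A B M N V W : 'M[R]_d) (x y z g : 'rV[R]_d) (a c l : R).

Definition bform A x y : R := (x *m A *m y^T) 0 0.
Definition sqnorm x : R := \sum_i x 0 i ^+ 2.

Lemma qformE A x : qform A x = bform A x x. Proof. by []. Qed.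

Lemma dotE x y : (x *m y^T) 0 0 = \sum_i x 0 i * y 0 i.
Proof. by rewrite mxE; apply: eq_bigr => i _; rewrite mxE. Qed.

Lemma sqnormE x : sqnorm x = (x *m x^T) 0 0.
Proof. by rewrite dotE; apply: eq_bigr => i _; rewrite expr2. Qed.

Lemma sqnorm_ge0 x : 0 <= sqnorm x.
Proof. by apply: sumr_ge0 => i _; exact: sqr_ge0. Qed.

Lemma sqnorm_eq0 x : (sqnorm x == 0) = (x == 0).
Proof.
apply/eqP/eqP => [x0|->]; last first.
  by rewrite /sqnorm big1// => i _; rewrite mxE expr0n.
apply/rowP => i; rewrite mxE; apply/eqP; rewrite -sqrf_eq0.
by move/eqP: x0; rewrite psumr_eq0 => [/allP/(_ i (mem_index_enum _))//|j _]; exact: sqr_ge0.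
Qed.

Lemma sqnorm_gt0 x : (0 < sqnorm x) = (x != 0).
Proof. by rewrite lt_neqAle sqnorm_ge0 andbT eq_sym sqnorm_eq0. Qed.

Lemma bformDm A B x y : bform (A + B) x y = bform A x y + bform B x y.
Proof. by rewrite /bform mulmxDr mulmxDl mxE. Qed.
Lemma bformNm A x y : bform (- A) x y = - bform A x y.
Proof. by rewrite /bform mulmxN mulNmx mxE. Qed.
Lemma bformZm a A x y : bform (a *: A) x y = a * bform A x y.
Proof. by rewrite /bform -scalemxAr -scalemxAl mxE. Qed.
Lemma bform_scalar a x y : bform a%:M x y = a * (x *m y^T) 0 0.
Proof. by rewrite /bform mul_mx_scalar -scalemxAl mxE. Qed.
Lemma bformDl A x y z : bform A (x + y) z = bform A x z + bform A y z.
Proof. by rewrite /bform !mulmxDl mxE. Qed.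
Lemma bformZl a A x y : bform A (a *: x) y = a * bform A x y.
Proof. by rewrite /bform -!scalemxAl mxE. Qed.
Lemma bformDr A x y z : bform A x (y + z) = bform A x y + bform A x z.
Proof. by rewrite /bform linearD mulmxDr mxE. Qed.
Lemma bformZr a A x y : bform A x (a *: y) = a * bform A x y.
Proof. by rewrite /bform linearZ -scalemxAr mxE. Qed.

Lemma qformD A B x : qform (A + B) x = qform A x + qform B x.
Proof. exact: bformDm. Qed.
Lemma qformN A x : qform (- A) x = - qform A x.
Proof. exact: bformNm. Qed.
Lemma qformZ a A x : qform (a *: A) x = a * qform A x.
Proof. exact: bformZm. Qed.
Lemma qform_scalar a x : qform a%:M x = a * sqnorm x.
Proof. by rewrite sqnormE -bform_scalar. Qed.
Lemma qform0 x : qform 0 x = 0.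
Proof. by rewrite /qform mulmx0 mul0mx mxE. Qed.

Lemma bformC A x y : bform A^T x y = bform A y x.
Proof.
rewrite /bform (_ : x *m A^T *m y^T = (y *m A *m x^T)^T) ?mxE//.
by rewrite !trmx_mul trmxK mulmxA.
Qed.

Lemma bform_sym A x y : A^T = A -> bform A x y = bform A y x.
Proof. by move=> sA; rewrite -{1}sA bformC. Qed.

Lemma bform_mull A B x y : bform (B *m A) x y = bform A (x *m B) y.
Proof. by rewrite /bform !mulmxA. Qed.

Lemma bform_mulr A B x y : bform (A *m B^T) x y = bform A x (y *m B).
Proof. by rewrite /bform trmx_mul !mulmxA. Qed.

Lemma qform_congr A B x : B^T = B -> qform (B *m A *m B) x = qform A (x *m B).
Proof. by move=> sB; rewrite /qform trmx_mul sB !mulmxA. Qed.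

Lemma tr_outer A x y : \tr (A *m (x^T *m y)) = bform A y x.
Proof. by rewrite /bform mulmxA mxtrace_mulC mulmxA trace_mx11. Qed.

Lemma qform_tr A x : qform A x = \tr (A *m (x^T *m x)).
Proof. by rewrite tr_outer. Qed.

Lemma qform_outer g x : qform (g^T *m g) x = ((x *m g^T) 0 0) ^+ 2.
Proof.
rewrite /qform !mulmxA -mulmxA mxE big_ord1 expr2; congr (_ * _).
by rewrite (_ : g *m x^T = (x *m g^T)^T) ?mxE// trmx_mul trmxK.
Qed.

Lemma bform_delta A (i j : 'I_d) : bform A (delta_mx 0 i) (delta_mx 0 j) = A i j.
Proof.
by rewrite /bform -rowE trmx_delta -colE !mxE.
Qed.

Lemma qform_line A x y a : A^T = A ->
  qform A (x + a *: y) = qform A x + 2 * a * bform A x y + a ^+ 2 * qform A y.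
Proof.
move=> sA; rewrite !qformE bformDl !bformDr !bformZl !bformZr (bform_sym y x sA).
by ring.
Qed.

End BilinearForms.

Section Spectral.
Context {R : realType}.

Lemma continuous_sumr (T : topologicalType) (I : Type) (r : seq I)
    (F : I -> T -> R) : (forall i, continuous (F i)) ->
  continuous (fun x => \sum_(i <- r) F i x).
Proof. by move=> cF; apply: continuous_big => //; exact: add_continuous. Qed.

Lemma continuous_mulmx_coord (n m : nat) (A : 'M[R]_(n, m)) (j : 'I_m) :
  continuous (fun x : 'rV[R]_n => (x *m A) 0 j).
Proof.
rewrite (_ : (fun x : 'rV[R]_n => (x *m A) 0 j) = (fun x => \sum_i x 0 i * A i j)).
  apply: continuous_sumr => i x.
  apply: (@continuousM _ _ (fun x : 'rV[R]_n => x 0 i) (fun=> A i j)).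
    exact: coord_continuous.
  exact: cst_continuous.
by apply/funext => y; rewrite mxE.
Qed.

Lemma continuous_qform (n : nat) (A : 'M[R]_n) : continuous (qform A).
Proof.
rewrite (_ : qform A = (fun x => \sum_i (x *m A) 0 i * x 0 i)).
  apply: continuous_sumr => i x.
  apply: (@continuousM _ _ (fun x : 'rV[R]_n => (x *m A) 0 i) (fun x : 'rV[R]_n => x 0 i)).
    exact: continuous_mulmx_coord.
  exact: coord_continuous.
by apply/funext => y; rewrite /qform dotE.
Qed.

Lemma quadratic_ge0_linear (q b : R) : 0 <= q ->
  (forall t, 0 <= 2 * t * b + t ^+ 2 * q) -> b = 0.
Proof.
(* Dividing by [q + 1] instead of [q] covers [q = 0], and the value of the quadratic there is still
   negative unless [b = 0]. *)
move=> q0 H; have := H (- b / (q + 1)).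
have q1 : 0 < q + 1 by rewrite ltr_wpDl.
have -> : 2 * (- b / (q + 1)) * b + (- b / (q + 1)) ^+ 2 * q
         = - (b ^+ 2 * (q + 2)) / (q + 1) ^+ 2 by field; rewrite gt_eqF.
rewrite mulNr oppr_ge0 pmulr_lle0; last by rewrite invr_gt0 exprn_gt0.
rewrite pmulr_lle0; last by rewrite ltr_wpDl.
by move=> b0; apply/eqP; rewrite -sqrf_eq0 eq_le b0 sqr_ge0.
Qed.

(* The Rayleigh quotient attains its minimum on the unit sphere of an invariant
   subspace, and a minimizer is an eigenvector. *)
Lemma eigenvector_orthogonal (n k : nat) (U : 'M[R]_(k, n)) (l : 'rV[R]_k)
    (N : 'M[R]_n) : N^T = N -> U *m N = diag_mx l *m U -> (k < n)%N ->
  exists a (v : 'rV[R]_n), [/\ v *m v^T = 1%:M, v *m U^T = 0 & v *m N = a *: v].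
Proof.
move=> sN UN kn.
pose S := [set v : 'rV[R]_n | v *m U^T = 0 /\ qform 1%:M v = 1].
have q1 (v : 'rV[R]_n) : qform 1%:M v = sqnorm v by rewrite qform_scalar mul1r.
have S0 : S !=set0.
  have : kermx (U^T) != 0.
    by rewrite -mxrank_eq0 mxrank_ker -lt0n subn_gt0 (leq_ltn_trans (rank_leq_col _)).
  case/rowV0Pn => w wk w0.
  have wU : w *m U^T = 0 by exact/sub_kermxP.
  exists ((Num.sqrt (sqnorm w))^-1 *: w); split; first by rewrite -scalemxAl wU scaler0.
  rewrite !qformE bformZl bformZr -qformE q1.
  rewrite mulrA -invfM -expr2 sqr_sqrtr ?sqnorm_ge0// mulVf//.
  by rewrite sqnorm_eq0.
have cS : compact S.
  apply: bounded_closed_compact.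
    exists 1; split => // x x1 v [_ v1]; rewrite /Num.norm /= mx_normrE.
    apply/bigmax_leP; split => [|[i j] _]; first exact: ltW (lt_trans _ x1).
    apply: (le_trans _ (ltW x1)); rewrite -(@expr_le1 _ 2)// real_normK ?num_real//.
    rewrite (ord1 i) -v1 q1 /sqnorm (bigD1 j)//= lerDl.
    by apply: sumr_ge0 => ? _; exact: sqr_ge0.
  have -> : S = (\bigcap_(j in [set: 'I_k]) ((fun v : 'rV[R]_n => (v *m U^T) 0 j) @^-1` [set 0]))
             `&` (qform 1%:M @^-1` [set 1]).
    apply/seteqP; split => [v [vU v1]|v [vU v1]]; split => //.
      by move=> j _ /=; rewrite vU mxE.
    by apply/rowP => j; rewrite (vU j I) mxE.
  apply: closedI.
    apply: closed_bigI => j _; apply: preimage_closed; last exact: closed_eq.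
    by move=> x _; exact: continuous_mulmx_coord.
  apply: preimage_closed; last exact: closed_eq.
  by move=> x _; exact: continuous_qform.
have [v /set_mem [vU v1] vmin] := EVT_min_rV S0 cS
  (continuous_subspaceT (@continuous_qform n N)).
pose a := qform N v; exists a, v.
have vv : v *m v^T = 1%:M.
  by apply/rowP => i; rewrite !ord1 -sqnormE -q1 v1 mxE.
have q_ge (y : 'rV[R]_n) : y *m U^T = 0 -> a * sqnorm y <= qform N y.
  move=> yU; have [->|y0] := eqVneq y 0.
    by rewrite /sqnorm big1 => [|i _]; rewrite ?mulr0 /qform ?mul0mx ?mxE// expr0n.
  have y1 : 0 < sqnorm y by rewrite sqnorm_gt0.
  have : (Num.sqrt (sqnorm y))^-1 *: y \in S.
    apply/mem_set; split; first by rewrite -scalemxAl yU scaler0.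
    rewrite !qformE bformZl bformZr -qformE q1 mulrA -invfM -expr2.
    by rewrite sqr_sqrtr ?mulVf ?gt_eqF// ltW.
  move/vmin; rewrite -/a [X in _ <= X]qformE bformZl bformZr -qformE.
  by rewrite mulrA -invfM -expr2 sqr_sqrtr ?(ltW y1)// mulrC ler_pdivlMr.
split=> //.
(* The form of [C] is nonnegative on the complement of the rows of [U] and vanishes at [v]; the
   first-order condition along [v + t y] then makes [v C] orthogonal to that complement. *)
pose C := N - a%:M.
have qC y : y *m U^T = 0 -> 0 <= qform C y.
  by move=> yU; rewrite qformD qformN qform_scalar subr_ge0 q_ge.
have qCv : qform C v = 0.
  by rewrite qformD qformN qform_scalar -q1 v1 mulr1 subrr.
have sC : C^T = C by rewrite /C linearB /= tr_scalar_mx sN.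
have vC (y : 'rV[R]_n) : y *m U^T = 0 -> bform C v y = 0.
  move=> yU; set b := bform C v y; set q := qform C y.
  have H t : 0 <= 2 * t * b + t ^+ 2 * q.
    have : 0 <= qform C (v + t *: y).
      by apply: qC; rewrite mulmxDl vU -scalemxAl yU scaler0 addr0.
    by rewrite qform_line// qCv add0r.
  exact: (quadratic_ge0_linear (qC y yU)).
(* By invariance [v C] itself lies in the complement, so it is orthogonal to itself. *)
have yU : (v *m C) *m U^T = 0.
  rewrite /C mulmxBr mulmxBl mul_mx_scalar -scalemxAl vU scaler0 subr0.
  rewrite -mulmxA -sN -trmx_mul UN trmx_mul tr_diag_mx mulmxA vU mul0mx //.
have := vC _ yU; rewrite /bform -sqnormE => /eqP; rewrite sqnorm_eq0.
by rewrite /C mulmxBr mul_mx_scalar subr_eq0 => /eqP.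
Qed.

Theorem real_spectral (n : nat) (N : 'M[R]_n) : N^T = N ->
  exists (O : 'M[R]_n) (l : 'rV[R]_n),
    [/\ O *m O^T = 1%:M, O^T *m O = 1%:M & N = O^T *m diag_mx l *m O].
Proof.
move=> sN.
have H k : (k <= n)%N -> exists (U : 'M[R]_(k, n)) (l : 'rV[R]_k),
    U *m U^T = 1%:M /\ U *m N = diag_mx l *m U.
  elim: k => [|k IH] kn.
    by exists 0, 0; split; apply/matrixP => -[].
  have [U [l [UU UN]]] := IH (ltnW kn).
  have [a [v [vv vU vN]]] := eigenvector_orthogonal sN UN kn.
  (* [1 + k] is convertible to [k.+1] and exposes the block structure of the enlarged family. *)
  suff : exists (W : 'M[R]_(1 + k, n)) (e : 'rV[R]_(1 + k)),
    W *m W^T = 1%:M /\ W *m N = diag_mx e *m W by [].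
  exists (col_mx v U : 'M[R]_(1 + k, n)), (row_mx a%:M l : 'rV[R]_(1 + k)); split.
    rewrite tr_col_mx mul_col_row vv vU UU.
    have -> : U *m v^T = 0 by rewrite -[LHS]trmxK trmx_mul trmxK vU trmx0.
    by rewrite -scalar_mx_block.
  rewrite mul_col_mx vN UN diag_mx_row mul_block_col !mul0mx addr0 add0r.
  congr col_mx; rewrite -mul_scalar_mx; congr (_ *m _).
  by apply/matrixP => i j; rewrite !mxE !ord1 /= !mulr1n.
have [U [l [UU UN]]] := H n (leqnn n).
exists U, l; split => //; first exact: mulmx1C.
by rewrite -mulmxA -UN mulmxA (mulmx1C UU) mul1mx.
Qed.

End Spectral.

(** Newton's scheme: the correction for a new node is a multiple of the product that vanishes at all
    the other nodes. *)
Lemma interpolation (R : fieldType) (s : seq R) (phi : R -> R) :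
  exists p : {poly R}, forall x, x \in s -> p.[x] = phi x.
Proof.
elim: s => [|a s [p ps]]; first by exists 0.
have [as_|as_] := boolP (a \in s).
  by exists p => x; rewrite inE => /predU1P[->|]; exact: ps.
pose q := \prod_(b <- s) ('X - b%:P).
have qa : q.[a] != 0.
  rewrite -[_ == 0]/(root q a) root_prod_XsubC //.
exists (p + ((phi a - p.[a]) / q.[a])%:P * q) => x; rewrite inE hornerD hornerM hornerC.
case/predU1P => [->|xs]; first by rewrite divfK// addrC subrK.
have /rootP -> : root q x by rewrite root_prod_XsubC.
by rewrite mulr0 addr0 ps.
Qed.

(** * Functional calculus of symmetric matrices inside a matrix algebra *)

Section SpectralCalculus.
Context {R : realType} {d : nat}.
Implicit Types (A B M N V W : 'M[R]_d) (x y z g : 'rV[R]_d) (a c : R).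
Implicit Types (K : set 'M[R]_d) (O : 'M[R]_d) (l : 'rV[R]_d) (phi psi : R -> R).

(** Stability under transposition is not part of the notion, so symmetry is requested separately
    wherever a test element of [K] is used. *)
Definition matrix_algebra K : Prop :=
  [/\ (forall a A, K A -> K (a *: A)), (forall A B, K A -> K B -> K (A + B)),
      (forall A B, K A -> K B -> K (A *m B)) & K 1%:M].

Lemma algebra_scalar K a : matrix_algebra K -> K a%:M.
Proof. by case=> KZ _ _ K1; rewrite -scalemx1; exact: KZ. Qed.

Lemma algebraN K A : matrix_algebra K -> K A -> K (- A).
Proof. by case=> KZ _ _ _ KA; rewrite -scaleN1r; exact: KZ. Qed.

Lemma algebraB K A B : matrix_algebra K -> K A -> K B -> K (A - B).
Proof. by move=> aK KA KB; case: (aK) => _ KD _ _; apply: KD => //; exact: algebraN. Qed.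

Definition spectral (O : 'M[R]_d) (l : 'rV[R]_d) (phi : R -> R) : 'M[R]_d :=
  O^T *m diag_mx (map_mx phi l) *m O.

Definition orthonormal_mx (O : 'M[R]_d) := O *m O^T = 1%:M /\ O^T *m O = 1%:M.

Lemma spectral_sym O l phi : (spectral O l phi)^T = spectral O l phi.
Proof. by rewrite /spectral !trmx_mul trmxK tr_diag_mx mulmxA. Qed.

Lemma spectralM O l phi psi : orthonormal_mx O ->
  spectral O l phi *m spectral O l psi = spectral O l (fun t => phi t * psi t).
Proof.
move=> [OO _]; rewrite /spectral !mulmxA -[_ *m O *m O^T]mulmxA OO mulmx1.
rewrite -[_ *m diag_mx _ *m diag_mx _]mulmxA mulmx_diag.
by congr (_ *m diag_mx _ *m _); apply/rowP => i; rewrite !mxE.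
Qed.

Lemma spectralD O l phi psi :
  spectral O l phi + spectral O l psi = spectral O l (fun t => phi t + psi t).
Proof.
rewrite /spectral -mulmxDl -mulmxDr -linearD /=.
by congr (_ *m diag_mx _ *m _); apply/rowP => i; rewrite !mxE.
Qed.

Lemma spectral_cst O l a : orthonormal_mx O -> spectral O l (fun=> a) = a%:M.
Proof.
move=> [_ OO]; rewrite /spectral (_ : diag_mx _ = a%:M).
  by rewrite mul_mx_scalar -scalemxAl OO scalemx1.
by apply/matrixP => i j; rewrite !mxE.
Qed.

Lemma spectral_id O l : spectral O l id = O^T *m diag_mx l *m O.
Proof. by rewrite /spectral map_mx_id. Qed.

Lemma eq_spectral O l phi psi : (forall i, phi (l 0 i) = psi (l 0 i)) ->
  spectral O l phi = spectral O l psi.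
Proof.
by move=> e; congr (_ *m diag_mx _ *m _); apply/rowP => i; rewrite !mxE.
Qed.

Lemma tr_spectral O l phi B :
  \tr (spectral O l phi *m B) = \sum_i phi (l 0 i) * qform B (row i O).
Proof.
rewrite /spectral -!mulmxA mxtrace_mulC -!mulmxA mul_diag_mx.
apply: eq_bigr => i _; rewrite mxE [X in X * _]mxE; congr (_ * _).
rewrite /qform tr_row -row_mul mulmxA !mxE; apply: eq_bigr => j _.
by rewrite !mxE.
Qed.

Lemma qform_spectral O l phi x :
  qform (spectral O l phi) x = \sum_i phi (l 0 i) * (x *m O^T) 0 i ^+ 2.
Proof.
rewrite qform_tr tr_spectral; apply: eq_bigr => i _; congr (_ * _).
rewrite qform_outer; congr (_ ^+ 2).
by rewrite !mxE; apply: eq_bigr => j _; rewrite !mxE mulrC.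
Qed.

Lemma qform_spectral_row O l phi i : orthonormal_mx O ->
  qform (spectral O l phi) (row i O) = phi (l 0 i).
Proof.
move=> [OO _]; rewrite qform_spectral (bigD1 i)//= -row_mul OO !mxE eqxx.
rewrite expr1n mulr1 big1 ?addr0// => j ji.
by rewrite !mxE eq_sym (negbTE ji) expr0n mulr0.
Qed.

Lemma row_orthonormal_neq0 O i : orthonormal_mx O -> row i O != 0.
Proof.
move=> [OO _]; apply/eqP => r0.
have : (row i O *m O^T) 0 i = 1 by rewrite -row_mul OO !mxE eqxx.
by rewrite r0 mul0mx mxE => /esym/eqP; rewrite oner_eq0.
Qed.

Lemma row_spectral O l phi i : orthonormal_mx O ->
  row i O *m spectral O l phi = phi (l 0 i) *: row i O.
Proof.
move=> [OO _]; rewrite /spectral !mulmxA -row_mul OO row1.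
by rewrite -rowE row_diag_mx -scalemxAl -rowE mxE.
Qed.

Lemma psd_spectral O l phi : (forall i, 0 <= phi (l 0 i)) -> psd (spectral O l phi).
Proof.
move=> p0; split; first exact: spectral_sym.
by move=> x; rewrite qform_spectral sumr_ge0// => i _; rewrite mulr_ge0// sqr_ge0.
Qed.

Lemma pd_spectral O l phi : orthonormal_mx O -> (forall i, 0 < phi (l 0 i)) ->
  pd (spectral O l phi).
Proof.
move=> oO p0; split; first exact: spectral_sym.
move=> x x0; have [_ pq] := psd_spectral O (fun i => ltW (p0 i)).
rewrite lt_neqAle pq andbT eq_sym; apply/eqP; rewrite qform_spectral => /eqP.
rewrite psumr_eq0 => [/allP H|i _]; last by rewrite mulr_ge0 ?sqr_ge0// ltW.
case/eqP: x0; case: oO => _ OO; rewrite -[x]mulmx1 -OO mulmxA.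
rewrite (_ : x *m O^T = 0) ?mul0mx//; apply/rowP => i; rewrite [RHS]mxE.
have := H i (mem_index_enum _); rewrite /= mulf_eq0 gt_eqF//= sqrf_eq0.
by move/eqP.
Qed.

(** On the finitely many eigenvalues [phi] agrees with a polynomial, and a unital algebra contains
    every polynomial in its elements. *)
Lemma algebra_spectral K O l phi : matrix_algebra K -> orthonormal_mx O ->
  K (spectral O l id) -> K (spectral O l phi).
Proof.
move=> aK oO KN; have [KZ KD KM K1] := aK.
have [p pP] := interpolation [seq l 0 i | i <- enum 'I_d] phi.
rewrite (@eq_spectral O l phi (horner p)); last first.
  by move=> i; rewrite pP//; apply/mapP; exists i => //; rewrite mem_enum.
elim/poly_ind: p {pP} => [|p c IH].
  rewrite (@eq_spectral O l _ (fun=> 0)) ?spectral_cst//; last by move=> i; rewrite horner0.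
  exact: algebra_scalar.
rewrite (@eq_spectral O l _ (fun t => p.[t] * id t + c)); last first.
  by move=> i; rewrite hornerD hornerMX hornerC.
rewrite -(spectralD _ _ (fun t => p.[t] * id t) (fun=> c)) spectral_cst//.
apply: KD; last exact: algebra_scalar.
by rewrite -spectralM//; exact: KM.
Qed.

Lemma symmetric_spectral N : N^T = N ->
  exists O l, orthonormal_mx O /\ N = spectral O l id.
Proof.
move=> /real_spectral[U [l [UU UU' ->]]]; exists U, l; split => //.
by rewrite spectral_id.
Qed.

Lemma pd_psd A : pd A -> psd A.
Proof.
move=> [sA pA]; split=> // x; have [->|x0] := eqVneq x 0; last exact/ltW/pA.
by rewrite /qform !mul0mx mxE.
Qed.

Lemma tr_psd_ge0 A B : psd A -> (forall x, 0 <= qform B x) -> 0 <= \tr (A *m B).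
Proof.
move=> [sA pA] pB; have [ O [l [oO AE]]] := symmetric_spectral sA.
rewrite AE tr_spectral; apply: sumr_ge0 => i _; rewrite mulr_ge0//.
by have := pA (row i O); rewrite AE qform_spectral_row.
Qed.

Lemma pd_unit A : pd A -> A \in unitmx.
Proof.
move=> [_ pA]; rewrite -row_free_unit -kermx_eq0; apply/rowV0P => x /sub_kermxP xA.
apply/eqP; apply: contraT => /pA; rewrite /qform xA mul0mx mxE ltxx//.
Qed.

Lemma invmx_sym A : A^T = A -> (invmx A)^T = invmx A.
Proof. by move=> sA; rewrite trmx_inv sA. Qed.

Lemma invmx_uniq A B : A *m B = 1%:M -> invmx A = B.
Proof.
move=> AB; have [uA _] := mulmx1_unit AB.
by rewrite -[RHS]mul1mx -(mulVmx uA) -mulmxA AB mulmx1.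
Qed.

Lemma spectral_inv O l : orthonormal_mx O -> (forall i, l 0 i != 0) ->
  invmx (spectral O l id) = spectral O l GRing.inv.
Proof.
move=> oO l0; apply: invmx_uniq; rewrite spectralM// -(spectral_cst l 1 oO).
by apply: eq_spectral => i; rewrite divff.
Qed.

Lemma pd_spectral_gt0 O l : orthonormal_mx O -> pd (spectral O l id) ->
  forall i, 0 < l 0 i.
Proof.
move=> oO [_ pA] i; rewrite -(qform_spectral_row l id i oO).
by apply: pA; exact: row_orthonormal_neq0.
Qed.

Lemma pd_inv A : pd A -> pd (invmx A).
Proof.
move=> pA; have [ O [l [oO AE]]] := symmetric_spectral pA.1.
have l0 := pd_spectral_gt0 oO (eq_ind A (@pd _ _) pA _ AE).
rewrite AE spectral_inv => [|//|i]; last by rewrite gt_eqF.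
by apply: pd_spectral => // i; rewrite invr_gt0.
Qed.

Lemma algebra_inv K A : matrix_algebra K -> K A -> pd A -> K (invmx A).
Proof.
move=> aK KA pA; have [ O [l [oO AE]]] := symmetric_spectral pA.1.
have l0 := pd_spectral_gt0 oO (eq_ind A (@pd _ _) pA _ AE).
rewrite AE spectral_inv => [|//|i]; last by rewrite gt_eqF.
by apply: algebra_spectral => //; rewrite -AE.
Qed.

(** Operator monotonicity of the square root. If [v] is an eigenvector of [A - B] for [l], then
    [A^2 - B^2 = (A - B) A + B (A - B)] has value [l] times the sum of the forms of [A] and [B] at
    [v]. That sum is positive, so [l >= 0]. *)
Lemma psd_le_of_sq A B : pd A -> psd B ->
  (forall x, qform (B *m B) x <= qform (A *m A) x) ->
  forall x, qform B x <= qform A x.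
Proof.
move=> pA pB le_sq x; have sN : (A - B)^T = A - B.
  by rewrite linearB /= pA.1 pB.1.
have [ O [l [oO NE]]] := symmetric_spectral sN.
rewrite -subr_ge0 -qformN -qformD NE.
have [] := @psd_spectral O l id => // i /=.
pose v := row i O; have v0 : v != 0 by exact: row_orthonormal_neq0.
have vN : v *m (A - B) = l 0 i *: v by rewrite NE row_spectral.
have : 0 <= l 0 i * (qform A v + qform B v).
  rewrite mulrDr.
  have -> : l 0 i * qform A v = bform ((A - B) *m A) v v.
    by rewrite bform_mull vN bformZl qformE.
  have -> : l 0 i * qform B v = bform (B *m (A - B)) v v.
    by rewrite -{1}sN bform_mulr vN bformZr qformE.
  rewrite -bformDm mulmxBl mulmxBr addrC.
  rewrite (_ : _ + _ = A *m A - B *m B); last first.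
    by rewrite addrC addrA subrK.
  by rewrite bformDm bformNm subr_ge0 -!qformE.
by rewrite pmulr_lge0// ltr_wpDr ?pA.2// pB.2.
Qed.

End SpectralCalculus.

(** * The projection on a matrix algebra and its square root *)

Section Projection.
Context {R : realType}.

(** If no independent family in [S] spanned it, each could be extended, up to [n + 1] independent
    rows of length [n]. *)
Lemma subspace_basis (n : nat) (S : set 'rV[R]_n) :
  exists k (B : 'M[R]_(k, n)),
    [/\ row_free B, (forall i, S (row i B)) & (forall a, S a -> (a <= B)%MS)].
Proof.
apply: contrapT => nomax.
have H k : exists B : 'M[R]_(k, n), row_free B /\ forall i, S (row i B).
  elim: k => [|k [B [fB SB]]].
    by exists 0; split; [rewrite /row_free mxrank0|case].
  have [a [Sa aB]] : exists a, S a /\ ~~ (a <= B)%MS.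
    apply: contrapT => all_in; apply: nomax; exists k, B; split => // a Sa.
    by apply: contrapT => /negP aB; apply: all_in; exists a.
  suff : exists W : 'M[R]_(1 + k, n), row_free W /\ forall i, S (row i W) by [].
  exists (col_mx a B); split.
    rewrite /row_free eqn_leq rank_leq_row /=.
    apply: (@leq_trans (\rank B).+1); first by rewrite (eqP fB).
    apply: rank_ltmx.
    by rewrite ltmxE col_mx_sub (negbTE aB) andbT -addsmxE addsmxSr.
  move=> i; rewrite -(splitK i); case: (fintype.split i) => j /=.
    by rewrite rowKu ord1 (_ : row 0 a = a)//; apply/rowP => q; rewrite mxE.
  by rewrite rowKd.
have [B [fB _]] := H n.+1.
by have := rank_leq_col B; rewrite (eqP fB) ltnn.
Qed.

(** The Gram matrix of a basis is invertible, and the normal equations give the projection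
    explicitly. *)
Lemma subspace_projection (n : nat) (S : set 'rV[R]_n) (m : 'rV[R]_n) :
  S 0 -> (forall c a, S a -> S (c *: a)) -> (forall a b, S a -> S b -> S (a + b)) ->
  exists s, S s /\ forall a, S a -> (m *m a^T) 0 0 = (s *m a^T) 0 0.
Proof.
move=> S0 SZ SD; have [k [B [fB SB BS]]] := subspace_basis S.
have uG : B *m B^T \in unitmx.
  rewrite -row_free_unit -kermx_eq0; apply/rowV0P => u /sub_kermxP.
  rewrite mulmxA => uBB; apply/eqP.
  rewrite -(mulmx_free_eq0 _ fB) -sqnorm_eq0 sqnormE trmx_mul mulmxA uBB.
  by rewrite mul0mx mxE.
exists (m *m B^T *m invmx (B *m B^T) *m B); split.
  rewrite mulmx_sum_row; elim/big_ind: _ => // i _; exact/SZ/SB.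
move=> a /BS /submxP[u ->]; rewrite trmx_mul !mulmxA.
by rewrite -[in RHS](mulmxA _ B) mulmxKV.
Qed.

Context {d : nat}.
Implicit Types (A B M N V W P X : 'M[R]_d) (x y z g : 'rV[R]_d) (a c : R).
Implicit Types (K : set 'M[R]_d).

Lemma mxvec_dot A B : (mxvec A *m (mxvec B)^T) 0 0 = \tr (A *m B^T).
Proof.
rewrite /mxtrace; under [RHS]eq_bigr do rewrite mxE.
rewrite pair_bigA dotE (reindex _ (curry_mxvec_bij _ _)) /=.
by apply: eq_bigr => -[i j] _ /=; rewrite !mxvecE mxE.
Qed.

(** Flattening by [mxvec] turns the Frobenius inner product into the dot product, for which the
    symmetric part of [K] is a subspace. *)
Lemma algebra_projection K M : matrix_algebra K ->
  exists N, [/\ K N, N^T = N & forall A, K A -> A^T = A -> \tr (M *m A) = \tr (N *m A)].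
Proof.
move=> aK; have [KZ KD KM K1] := aK.
pose S : set 'rV[R]_(d * d) := [set v | K (vec_mx v) /\ (vec_mx v)^T = vec_mx v].
have S0 : S 0.
  by rewrite /S /= !linear0; split => //; rewrite -(scale0r 1%:M); exact: KZ.
have SZ c v : S v -> S (c *: v).
  by case=> Ka sa; rewrite /S /= !linearZ /= sa; split => //; exact: KZ.
have SD v w : S v -> S w -> S (v + w).
  by case=> Ka sa [Kb sb]; rewrite /S /= !linearD /= sa sb; split => //; exact: KD.
have [s [[Ks ss] sP]] := subspace_projection (mxvec M) S0 SZ SD.
exists (vec_mx s); split => // A KA sA.
have /sP : S (mxvec A) by rewrite /S /= mxvecK.
by rewrite -[s]vec_mxK !mxvec_dot sA vec_mxK.
Qed.

(** The spectral projector of [N] on its negative eigenvalues lies in [K]; tested against it, [N]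
    would have a negative trace. *)
Lemma algebra_psd K N : matrix_algebra K -> K N -> N^T = N ->
  (forall A, K A -> psd A -> 0 <= \tr (N *m A)) -> psd N.
Proof.
move=> aK KN sN posN; have [ O [l [oO NE]]] := symmetric_spectral sN.
rewrite NE; apply: psd_spectral => i; rewrite leNgt; apply/negP => li.
pose phi (t : R) : R := if t < 0 then 1 else 0.
have := posN (spectral O l phi).
have KA : K (spectral O l phi) by apply: algebra_spectral => //; rewrite -NE.
have pA : psd (spectral O l phi) by apply: psd_spectral => j; rewrite /phi; case: ifP.
move=> /(_ KA pA); rewrite mxtrace_mulC tr_spectral; apply/negP; rewrite -ltNge.
  rewrite (bigD1 i)//= /phi li mul1r NE qform_spectral_row// ltr_wnDr// sumr_le0//.
  move=> j _; rewrite qform_spectral_row//=; case: (ltP (l 0 j) 0) => [/ltW|]; lra.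
Qed.

(** The trace identity says that [V^2] is the projection of [M] on the symmetric part of [K]. This
    is the working description of [PH]: any symmetric test element of [K] allows [M] to be exchanged
    for [V^2]. *)
Definition algebra_sqrt K M V :=
  [/\ K V, pd V & forall A, K A -> A^T = A -> \tr (M *m A) = \tr (V *m V *m A)].

Lemma algebra_sqrt_exists K M : matrix_algebra K ->
  (forall x, x != 0 -> 0 < qform M x) -> exists V, algebra_sqrt K M V.
Proof.
move=> aK posM; have [N [KN sN NP]] := algebra_projection M aK.
have [ O [l [oO NE]]] := symmetric_spectral sN.
(* The projector on the eigenvalues [<= 0] of [N] is in [K]. If it were nonzero, its trace against
   [M] would be positive and against [N] nonpositive, though the two agree. *)
have l0 i : 0 < l 0 i.
  rewrite ltNge; apply/negP => li.
  pose phi (t : R) : R := if t <= 0 then 1 else 0.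
  have KA : K (spectral O l phi) by apply: algebra_spectral => //; rewrite -NE.
  have := NP _ KA (spectral_sym _ _ _).
  rewrite [LHS]mxtrace_mulC [RHS]mxtrace_mulC !tr_spectral; apply/eqP; rewrite gt_eqF//.
  apply: (@le_lt_trans _ _ 0).
    apply: sumr_le0 => j _; rewrite NE qform_spectral_row// /phi.
    by case: (leP (l 0 j) 0) => //=; lra.
  rewrite (bigD1 i)//= /phi li mul1r ltr_wpDr//.
    apply: sumr_ge0 => j _; rewrite mulr_ge0 /phi//; first by case: ifP.
    exact/ltW/posM/row_orthonormal_neq0.
  exact/posM/row_orthonormal_neq0.
exists (spectral O l Num.sqrt); split.
- by apply: algebra_spectral => //; rewrite -NE.
- by apply: pd_spectral => // i; rewrite sqrtr_gt0.
- move=> A KA sA; rewrite NP// NE spectralM//; congr (\tr (_ *m _)).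
  by apply: eq_spectral => i; rewrite -expr2 sqr_sqrtr// ltW.
Qed.

Lemma qform_sq A x : A^T = A -> qform (A *m A) x = sqnorm (x *m A).
Proof. by move=> sA; rewrite sqnormE /qform trmx_mul sA !mulmxA. Qed.

Lemma tr_congr_ge0 P X : pd P -> X^T = X -> 0 <= \tr (X *m P *m X).
Proof.
move=> pP sX; rewrite mxtrace_mulC mulmxA mxtrace_mulC.
by apply: tr_psd_ge0; [exact: pd_psd|move=> x; rewrite qform_sq// sqnorm_ge0].
Qed.

Lemma tr_congr_eq0 P X : pd P -> X^T = X -> \tr (X *m P *m X) = 0 -> X = 0.
Proof.
move=> pP sX; rewrite mxtrace_mulC mulmxA mxtrace_mulC.
have [ O [l [oO PE]]] := symmetric_spectral pP.1.
have l0 := pd_spectral_gt0 oO (eq_ind P (@pd _ _) pP _ PE).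
rewrite PE tr_spectral => /eqP; rewrite psumr_eq0 => [/allP H|i _]; last first.
  by rewrite mulr_ge0 ?qform_sq ?sqnorm_ge0// ltW.
rewrite -[X]mul1mx -oO.2 -mulmxA (_ : O *m X = 0) ?mulmx0//.
apply/row_matrixP => i; rewrite row_mul row0.
have := H i (mem_index_enum _); rewrite mulf_eq0 gt_eqF//= qform_sq// sqnorm_eq0.
by move/eqP.
Qed.

(** A completed square: [W^-1] is a symmetric element of [K], so [M] becomes [V^2]. The remainder is
    nonnegative and vanishes only for [W = V]. *)
Lemma algebra_sqrt_variational K M V W : matrix_algebra K -> algebra_sqrt K M V ->
  K W -> pd W -> \tr (M *m invmx W) + \tr W =
    2 * \tr V + \tr ((V - W) *m invmx W *m (V - W)).
Proof.
move=> aK [KV pV VP] KW pW.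
have uW := pd_unit pW.
rewrite VP ?invmx_sym ?pW.1//; last exact: algebra_inv.
rewrite !mulmxBl !mulmxBr mulmxV// mul1mx -[V *m invmx W *m W]mulmxA mulVmx// mulmx1.
rewrite mul1mx -[in LHS]mulmxA [\tr (V *m (V *m invmx W))]mxtrace_mulC.
by rewrite !linearB /=; ring.
Qed.

(** The completed square makes [V] a minimizer, so the default value of [xget] is excluded. It also
    makes the remainder zero at the minimizer that [xget] picks, which is therefore [V]. *)
Lemma PH_algebra_sqrt (H : set 'M[R]_d) K M : matrix_algebra K -> H = @psd R d `&` K ->
  (forall x, x != 0 -> 0 < qform M x) -> algebra_sqrt K M (PH H M).
Proof.
move=> aK HK posM; have [V sV] := algebra_sqrt_exists aK posM.
have [KV pV VP] := sV.
have frobE W : pd W -> frob M (invmx W) = \tr (M *m invmx W).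
  move=> pW; rewrite /frob -mxtrace_tr trmx_mul trmxK invmx_sym ?pW.1//.
  exact: mxtrace_mulC.
have VV : \tr ((V - V) *m invmx V *m (V - V)) = 0 by rewrite subrr mulmx0 linear0.
have HV : H V by rewrite HK; split => //; exact: pd_psd.
have iV : is_PH H M V.
  split => //; rewrite HK => W [_ KW] pW; rewrite !frobE//.
  rewrite (algebra_sqrt_variational aK sV KV pV) VV (algebra_sqrt_variational aK sV KW pW).
  rewrite lerD2l; apply: tr_congr_ge0; first exact: pd_inv.
  by rewrite linearB /= pV.1 pW.1.
have [] : is_PH H M (PH H M) by apply: xgetPex; exists V.
rewrite [H in H (PH _ _)]HK; set W := PH H M => -[_ KW] pW /(_ V HV pV).
rewrite !frobE// (algebra_sqrt_variational aK sV KV pV) VV.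
rewrite (algebra_sqrt_variational aK sV KW pW) lerD2l => le0.
suff /eqP : V - W = 0 by rewrite subr_eq0 => /eqP <-.
have sX : (V - W)^T = V - W by rewrite linearB /= pV.1 pW.1.
apply: (tr_congr_eq0 (pd_inv pW)) => //; apply/eqP; rewrite eq_le le0 /=.
by apply: tr_congr_ge0 => //; exact: pd_inv.
Qed.

End Projection.

(** * Order, perturbation and trace inequalities for the square root of a projection *)

Section AlgebraSqrt.
Context {R : realType} {d : nat}.
Implicit Types (A B M N V W D Q U Y X Z : 'M[R]_d) (x y z g h : 'rV[R]_d) (a c s : R).
Implicit Types (K : set 'M[R]_d).

Lemma qform_congr_inv V x : pd V -> qform V (x *m invmx V) = qform (invmx V) x.
Proof.
move=> pV; rewrite -qform_congr ?invmx_sym ?pV.1//.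
by rewrite mulVmx ?mul1mx//; exact: pd_unit.
Qed.

Lemma bform_invr V x y : pd V -> bform V x (y *m invmx V) = (x *m y^T) 0 0.
Proof.
move=> pV; rewrite -bform_mulr invmx_sym ?pV.1// mulmxV ?bform_scalar ?mul1r//.
exact: pd_unit.
Qed.

Lemma qform_subr A x y : A^T = A ->
  qform A (x - y) = qform A x - 2 * bform A x y + qform A y.
Proof. by move=> sA; rewrite -scaleN1r qform_line//; ring. Qed.

(** Expand the nonnegative form of [D] at [x - x D W^-1]: the cross term is the form of [D W^-1 D]
    at [x], and the last term is at most that, because [D <= W]. *)
Lemma qform_congr_inv_le D W x : psd D -> pd W ->
  (forall z, qform D z <= qform W z) -> qform (D *m invmx W *m D) x <= qform D x.
Proof.
move=> [sD pD] pW DW; rewrite qform_congr//.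
have := pD (x - x *m D *m invmx W); rewrite qform_subr//.
have := DW (x *m D *m invmx W); rewrite qform_congr_inv//.
have -> : bform D x (x *m D *m invmx W) = qform (invmx W) (x *m D).
  by rewrite /bform trmx_mul invmx_sym ?pW.1// !mulmxA.
lra.
Qed.

(** Expand the form of [V] at [x U^-1 - x V^-1] and bound the first square by means of [V <= U]. *)
Lemma qform_inv_anti V U x : pd V -> pd U ->
  (forall z, qform V z <= qform U z) -> qform (invmx U) x <= qform (invmx V) x.
Proof.
move=> pV pU VU.
have := (pd_psd pV).2 (x *m invmx U - x *m invmx V); rewrite qform_subr ?pV.1//.
have := VU (x *m invmx U); rewrite !qform_congr_inv// bform_invr//.
have -> : (x *m invmx U *m x^T) 0 0 = qform (invmx U) x by [].
lra.
Qed.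

(** The projection on the symmetric part of [K] preserves positivity and fixes scalar matrices, so
    it transports the inequality. *)
Lemma algebra_sqrt_sq_le K M1 V1 M2 V2 c : matrix_algebra K -> 0 <= c ->
  algebra_sqrt K M1 V1 -> algebra_sqrt K M2 V2 ->
  (forall x, qform M1 x <= qform M2 x + c * sqnorm x) ->
  forall x, qform (V1 *m V1) x <= qform (V2 *m V2) x + c * sqnorm x.
Proof.
move=> aK c0 [KV1 pV1 V1P] [KV2 pV2 V2P] le12 x.
have [KZ KD KM K1] := aK.
have [] : psd (V2 *m V2 + c%:M - V1 *m V1).
  apply: (algebra_psd aK).
  - apply: algebraB => //; last exact: KM.
    by apply: KD; [exact: KM|exact: algebra_scalar].
  - by rewrite !linearD linearN /= !trmx_mul tr_scalar_mx pV1.1 pV2.1.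
  - move=> A KA pA; have sA := pA.1.
    rewrite mulmxBl mulmxDl linearB linearD /= -V1P// -V2P// -linearD -linearB /=.
    rewrite -mulmxDl -mulmxBl mxtrace_mulC; apply: tr_psd_ge0 => // y.
    by rewrite !qformD qformN qform_scalar subr_ge0.
by move=> _ /(_ x); rewrite !qformD qformN qform_scalar subr_ge0.
Qed.

(** [V1^2 <= V2^2 + c I <= (V2 + sqrt c I)^2], and the square root is operator monotone. *)
Lemma algebra_sqrt_le K M1 V1 M2 V2 c : matrix_algebra K -> 0 <= c ->
  algebra_sqrt K M1 V1 -> algebra_sqrt K M2 V2 ->
  (forall x, qform M1 x <= qform M2 x + c * sqnorm x) ->
  forall x, qform V1 x <= qform V2 x + Num.sqrt c * sqnorm x.
Proof.
move=> aK c0 sq1 sq2 le12 x.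
have le_sq := algebra_sqrt_sq_le aK c0 sq1 sq2 le12.
have [[_ pV1 _] [_ pV2 _]] := (sq1, sq2).
have s0 := sqrtr_ge0 c; set s := Num.sqrt c in s0 *.
rewrite -qform_scalar -qformD; apply: psd_le_of_sq; last 2 first.
- exact: pd_psd.
- move=> y; apply: (le_trans (le_sq y)); rewrite mulmxDl !mulmxDr.
  rewrite mul_mx_scalar mul_scalar_mx -scalar_mxM -expr2 sqr_sqrtr// !qformD qform_scalar.
  rewrite qformZ; have := mulr_ge0 s0 ((pd_psd pV2).2 y); lra.
- split; first by rewrite linearD /= tr_scalar_mx pV2.1.
  by move=> y y0; rewrite qformD qform_scalar ltr_wpDr ?pV2.2// mulr_ge0// sqnorm_ge0.
Qed.

Lemma algebra_sqrt_mono K M1 V1 M2 V2 : matrix_algebra K ->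
  algebra_sqrt K M1 V1 -> algebra_sqrt K M2 V2 ->
  (forall x, qform M1 x <= qform M2 x) -> forall x, qform V1 x <= qform V2 x.
Proof.
move=> aK sq1 sq2 le12 x.
have := @algebra_sqrt_le K M1 V1 M2 V2 0 aK (lexx 0) sq1 sq2 _ x.
by rewrite sqrtr0 mul0r addr0; apply => y; rewrite mul0r addr0.
Qed.

Lemma algebra_sqrt_tr K M V : matrix_algebra K -> algebra_sqrt K M V ->
  \tr (M *m invmx V) = \tr V.
Proof.
move=> aK [KV pV VP]; rewrite VP ?mulmxK ?pd_unit//; first exact: algebra_inv.
by rewrite invmx_sym ?pV.1.
Qed.

(* [V ^ 2] dominates the projection of [g^T g] on the algebra. *)
Lemma sqnorm_algebra_sqrt_inv_le K M V g : matrix_algebra K -> algebra_sqrt K M V ->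
  (forall x, qform (g^T *m g) x <= qform M x) -> sqnorm (g *m invmx V) <= d%:R.
Proof.
move=> aK [KV pV VP] gM; have [KZ KD KM K1] := aK.
have sI : (invmx V)^T = invmx V by rewrite invmx_sym ?pV.1.
have KI : K (invmx V) by exact: algebra_inv.
(* [V^-2] is a symmetric element of [K], so [M] may be exchanged for [V^2], leaving the trace of the
   identity. *)
have E : \tr (M *m (invmx V *m invmx V)) = d%:R.
  rewrite VP; [|exact: (KM _ _ KI KI)|by rewrite trmx_mul sI].
  by rewrite mulmxA mulmxK ?pd_unit// mulmxV ?pd_unit// mxtrace1.
rewrite -qform_sq// qform_tr mxtrace_mulC -E -subr_ge0 -linearB /= -mulmxBl mxtrace_mulC.
apply: tr_psd_ge0.
  by split; [rewrite trmx_mul sI|move=> z; rewrite qform_sq// sqnorm_ge0].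
by move=> z; rewrite qformD qformN subr_ge0.
Qed.

Lemma tr_qform_le A B : (forall x, qform A x <= qform B x) -> \tr A <= \tr B.
Proof.
move=> AB; apply: ler_sum => i _; rewrite -(bform_delta A) -(bform_delta B).
exact: AB.
Qed.

(* [V^-1 - U^-1 = U^-1 (U - V) V^-1], Young's inequality in the norm of [U^-1], and
   [(U - V) U^-1 (U - V) <= U - V <= s I]. *)
Lemma bform_inv_perturb V U s g h : pd V -> pd U ->
  (forall x, qform V x <= qform U x) ->
  (forall x, qform U x <= qform V x + s * sqnorm x) ->
  bform (invmx U) h g - qform (invmx U) h / 2 - s / 2 * sqnorm (g *m invmx V)
    <= bform (invmx V) h g.
Proof.
move=> pV pU VU UV.
have [uV uU] := (pd_unit pV, pd_unit pU).
pose D := U - V; pose y := g *m invmx V.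
have sD : D^T = D by rewrite /D linearB /= pV.1 pU.1.
have psdD : psd D by split => // x; rewrite qformD qformN subr_ge0.
have DU x : qform D x <= qform U x.
  by rewrite qformD qformN lerBlDr lerDl (pd_psd pV).2.
have -> : bform (invmx V) h g = bform (invmx U) h g + bform (invmx U) h (y *m D).
  rewrite -bformDr; congr (_ 0 0); rewrite /bform.
  have E : invmx U *m (g + y *m D)^T = invmx V *m g^T.
    rewrite linearD /= !trmx_mul sD invmx_sym ?pV.1// /D.
    rewrite mulmxDr !mulmxBl mulmxBr !mulmxA mulVmx// mul1mx.
    rewrite -[_ *m V *m invmx V]mulmxA mulmxV// mulmx1; first by rewrite addrC subrK.
  by rewrite -[h *m invmx V *m _]mulmxA -[h *m invmx U *m _]mulmxA E.
have yD : qform (invmx U) (y *m D) <= s * sqnorm y.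
  rewrite -qform_congr//; apply: (le_trans (qform_congr_inv_le _ psdD pU DU)).
  by rewrite qformD qformN lerBlDl.
(* Young's inequality: this nonnegative square bounds the cross term below by minus half the sum of
   the two squares. *)
have := (pd_psd (pd_inv pU)).2 (h + 1 *: (y *m D)).
rewrite qform_line ?invmx_sym ?pU.1//.
rewrite -/y; set b := bform _ _ (y *m D); set q := qform _ _ in yD *.
set r := qform _ h; lra.
Qed.

(** Against [U^-1], the term [h^T h] is the difference of [Tr U] and [Tr (Y U^-1 Y)]. Finally
    [Y U^-1 Y <= Y], which is [D U^-1 D <= D] for [D = U - Y], expanded. *)
Lemma algebra_sqrt_rank1_drop K M Y U h : matrix_algebra K ->
  algebra_sqrt K M Y -> algebra_sqrt K (M + h^T *m h) U ->
  \tr U - \tr Y <= qform (invmx U) h.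
Proof.
move=> aK sY sU; have [[KY pY YP] [KU pU UP]] := (sY, sU).
have [KZ KD KM K1] := aK.
have sIU : (invmx U)^T = invmx U by rewrite invmx_sym ?pU.1.
have YU := algebra_sqrt_mono aK sY sU _.
have {}YU x : qform Y x <= qform U x.
  by apply: YU => z; rewrite qformD lerDl qform_outer sqr_ge0.
have -> : qform (invmx U) h = \tr U - \tr (Y *m invmx U *m Y).
  rewrite -(algebra_sqrt_tr aK sU) mulmxDl linearD /= (YP (invmx U))//; last exact: algebra_inv.
  have -> : \tr (Y *m Y *m invmx U) = \tr (Y *m invmx U *m Y).
    by rewrite -mulmxA mxtrace_mulC.
  by rewrite qform_tr [\tr (h^T *m h *m _)]mxtrace_mulC addrAC subrr add0r.
rewrite lerD2l lerN2; apply: tr_qform_le => x.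
pose D := U - Y.
have sD : D^T = D by rewrite /D linearB /= pY.1 pU.1.
have psdD : psd D by split => // z; rewrite qformD qformN subr_ge0.
have DU z : qform D z <= qform U z.
  by rewrite qformD qformN lerBlDr lerDl (pd_psd pY).2.
have := qform_congr_inv_le x psdD pU DU.
have -> : D *m invmx U *m D = U - Y - Y + Y *m invmx U *m Y.
  rewrite /D !mulmxBl !mulmxBr mulmxV ?pd_unit// mul1mx -[Y *m invmx U *m U]mulmxA.
  by rewrite mulVmx ?pd_unit// mulmx1 mul1mx opprB addrA addrAC.
rewrite !qformD !qformN; lra.
Qed.

(* The trace of the square root is a nuclear norm, hence convex in [s]: the
   competitor [b + s (U - b)] in the variational characterization shows it. *)
Lemma algebra_sqrt_tr_convex K Q B b U Y s : matrix_algebra K -> 0 <= s <= 1 ->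
  algebra_sqrt K B b -> algebra_sqrt K (Q + B) U -> algebra_sqrt K (s ^+ 2 *: Q + B) Y ->
  (forall x, 0 <= qform Q x) ->
  \tr Y <= \tr b + s * (\tr U - \tr b).
Proof.
move=> aK /andP[s0 s1] sb sU sY Q0.
have [[[Kb pb bP] [KU pU UP]] [KY pY YP]] := (sb, sU, sY).
have [KZ KD KM K1] := aK.
pose D := U - b; pose W := b + s *: D.
have bU x : qform b x <= qform U x.
  by apply: (algebra_sqrt_mono aK sb sU) => z; rewrite qformD lerDr.
have sD : D^T = D by rewrite /D linearB /= pb.1 pU.1.
have psdD : psd D by split => // x; rewrite qformD qformN subr_ge0.
have KD' : K D by exact: algebraB.
have KW : K W by apply: KD => //; exact: KZ.
have pW : pd W.
  split; first by rewrite /W linearD linearZ /= sD pb.1.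
  by move=> x x0; rewrite qformD qformZ ltr_wpDr ?pb.2// mulr_ge0// psdD.2.
have uW := pd_unit pW.
have sIW : (invmx W)^T = invmx W by rewrite invmx_sym ?pW.1.
have KIW : K (invmx W) by exact: algebra_inv.
have trW : \tr W = \tr b + s * (\tr U - \tr b).
  by rewrite /W linearD linearZ /= linearB.
have := algebra_sqrt_variational aK sY KW pW.
have : 0 <= \tr ((Y - W) *m invmx W *m (Y - W)).
  apply: tr_congr_ge0; first exact: pd_inv.
  by rewrite linearB /= pY.1 pW.1.
rewrite -trW.
(* The completed square bounds [2 Tr Y] by the objective at [W], so it is enough that its first half
   is at most [Tr W]. *)
suff : \tr ((s ^+ 2 *: Q + B) *m invmx W) <= \tr W by lra.
(* [s^2 Q + B = s^2 (Q + B) + (1 - s^2) B], and the two parts project to [U^2] and [b^2]. *)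
have -> : \tr ((s ^+ 2 *: Q + B) *m invmx W)
    = s ^+ 2 * \tr (U *m U *m invmx W) + (1 - s ^+ 2) * \tr (b *m b *m invmx W).
  rewrite -UP// -bP// !mulmxDl -scalemxAl !mxtraceD mxtraceZ; ring.
have E1 : \tr (U *m U *m invmx W) = \tr (b *m b *m invmx W)
    + 2 * \tr (b *m D *m invmx W) + \tr (D *m D *m invmx W).
  have EbD : \tr (b *m D *m invmx W) = \tr (D *m b *m invmx W).
    by rewrite -mxtrace_tr !trmx_mul sIW sD pb.1 mxtrace_mulC.
  have -> : U *m U = (D + b) *m (D + b) by rewrite subrK.
  have sqE X Z : \tr ((X + Z) *m (X + Z) *m invmx W) =
      \tr (X *m X *m invmx W) + \tr (Z *m X *m invmx W) +
      (\tr (X *m Z *m invmx W) + \tr (Z *m Z *m invmx W)).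
    by rewrite mulmxDr !mulmxDl !mxtraceD.
  rewrite sqE -EbD.
  ring.
have E2 : \tr (b *m b *m invmx W) + s * \tr (b *m D *m invmx W) = \tr b.
  rewrite -linearZ -linearD /= scalemxAl scalemxAr -mulmxDl -mulmxDr -/W.
  by rewrite mulmxK.
have E3 : \tr (b *m D *m invmx W) + s * \tr (D *m D *m invmx W) = \tr D.
  rewrite -linearZ -linearD /= scalemxAl scalemxAl -mulmxDl -mulmxDl -/W.
  by rewrite mxtrace_mulC mulmxA mulVmx// mul1mx.
have E4 : s * \tr (D *m D *m invmx W) <= \tr D.
  rewrite [\tr (D *m D *m _)]mxtrace_mulC mulmxA mxtrace_mulC mulmxA -linearZ /=.
  apply: tr_qform_le => x; rewrite qformZ.
  have [->|sp] := eqVneq s 0; first by rewrite mul0r psdD.2.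
  have {}sp : 0 < s by rewrite lt_neqAle eq_sym sp s0.
  have psD : psd (s *: D) by split=> [|z]; rewrite ?linearZ /= ?sD// qformZ mulr_ge0// psdD.2.
  have := @qform_congr_inv_le (s *: D) W x psD pW _.
  rewrite -scalemxAr -!scalemxAl !qformZ ler_pM2l//; apply => z.
  by rewrite qformD lerDr (pd_psd pb).2.
have E5 : \tr D = \tr U - \tr b by rewrite linearB.
(* With [p + s q = Tr b] and [q + s r = Tr D], the goal [p + 2 s^2 q + s^2 r <= Tr b + s Tr D]
   reduces to [0 <= s q (1 - s)]. Here [q >= 0] because [s r <= Tr D]. *)
rewrite E1 trW -E5.
set p := \tr (b *m b *m invmx W) in E2 *.
set q := \tr (b *m D *m invmx W) in E2 E3 *.
set r := \tr (D *m D *m invmx W) in E3 E4 *.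
have -> : p = \tr b - s * q by lra.
have q0 : 0 <= q by lra.
have s1' : 0 <= 1 - s by rewrite subr_ge0.
have := mulr_ge0 (mulr_ge0 s0 q0) s1'.
rewrite -E3; nra.
Qed.

End AlgebraSqrt.

(** * Norms and real inequalities *)

Section Norms.
Context {R : realType} {d : nat}.
Implicit Types (A B S V : 'M[R]_d) (x y z : 'rV[R]_d) (a b c t : R).
Implicit Types (H K : set 'M[R]_d).

Lemma quadratic_ge0_discr a b c : 0 <= c ->
  (forall t, 0 <= a + 2 * t * b + t ^+ 2 * c) -> b ^+ 2 <= a * c.
Proof.
rewrite le_eqVlt => /predU1P[<-|c0] P.
  have [->|b0] := eqVneq b 0; first by rewrite expr0n mulr0.
  (* For [c = 0] the polynomial is affine in [t]; this point gives it the value [-1]. *)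
  have := P (- (a + 1) / (2 * b)).
  have -> : a + 2 * (- (a + 1) / (2 * b)) * b + (- (a + 1) / (2 * b)) ^+ 2 * 0 = -1.
    by field.
  by rewrite oppr_ge0 leNgt ltr01.
have := P (- b / c).
have -> : a + 2 * (- b / c) * b + (- b / c) ^+ 2 * c = (a * c - b ^+ 2) / c.
  by field; rewrite gt_eqF.
by rewrite pmulr_lge0 ?invr_gt0// subr_ge0.
Qed.

Lemma bform_cauchy_schwarz A x y : psd A ->
  bform A x y ^+ 2 <= qform A x * qform A y.
Proof.
move=> [sA pA]; apply: quadratic_ge0_discr => // t.
by rewrite -qform_line.
Qed.

Lemma psd_scalar c : 0 <= c -> psd (c%:M : 'M[R]_d).
Proof.
move=> c0; split; first exact: tr_scalar_mx.
by move=> x; rewrite qform_scalar mulr_ge0// sqnorm_ge0.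
Qed.

Lemma dot_cauchy_schwarz x y : (x *m y^T) 0 0 ^+ 2 <= sqnorm x * sqnorm y.
Proof.
have := bform_cauchy_schwarz x y (psd_scalar ler01).
by rewrite bform_scalar !qform_scalar !mul1r.
Qed.

Lemma psd_tr_ge0 A : psd A -> 0 <= \tr A.
Proof.
move=> pA; rewrite -[A]mulmx1; apply: tr_psd_ge0 => // x.
by rewrite qform_scalar mul1r sqnorm_ge0.
Qed.

(** Cauchy-Schwarz reads [x^T x <= |x|^2 I]; take the trace of this against [A]. *)
Lemma qform_le_tr A x : psd A -> qform A x <= \tr A * sqnorm x.
Proof.
move=> pA; rewrite -subr_ge0 qform_tr mulrC -mxtraceZ.
rewrite -mul_mx_scalar -linearB /= -mulmxBr; apply: tr_psd_ge0 => // z.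
rewrite qformD qformN qform_scalar qform_outer subr_ge0 [X in _ <= X]mulrC.
exact: dot_cauchy_schwarz.
Qed.

Lemma norm2E x : norm2 x = Num.sqrt (sqnorm x). Proof. by []. Qed.

(** On an unbounded set [sup] is a default value, so a bound must precede any use of [opnorm]; the
    Frobenius norm provides it. *)
Lemma opnorm_ubound A :
  has_ubound [set norm2 (x *m A) | x in [set x : 'rV[R]_d | norm2 x <= 1]].
Proof.
exists (Num.sqrt (\tr (A *m A^T))) => _ [x /= x1 <-].
rewrite norm2E ler_wsqrtr// sqnormE trmx_mul.
have -> : x *m A *m (A^T *m x^T) = x *m (A *m A^T) *m x^T by rewrite !mulmxA.
have pA : psd (A *m A^T).
  split; first by rewrite trmx_mul trmxK.
  by move=> z; rewrite /qform mulmxA -mulmxA -trmx_mul -sqnormE sqnorm_ge0.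
have := qform_le_tr x pA; rewrite /qform mulmxA => /le_trans; apply.
rewrite ler_piMr ?psd_tr_ge0//; move: x1; rewrite norm2E -[X in _ <= X -> _]sqrtr1.
by rewrite ler_psqrt ?nnegrE ?sqnorm_ge0.
Qed.

Lemma opnorm_ge0 A : 0 <= opnorm A.
Proof.
apply: (ub_le_sup (opnorm_ubound A)); exists 0 => /=.
  by rewrite norm2E -[sqnorm 0]/(sqnorm 0) (eqP (_ : sqnorm 0 == 0)) ?sqnorm_eq0// sqrtr0 ler01.
by rewrite mul0mx norm2E (eqP (_ : sqnorm 0 == 0)) ?sqnorm_eq0// sqrtr0.
Qed.

Lemma qform_le_opnorm A x : qform A x <= opnorm A * sqnorm x.
Proof.
have [->|x0] := eqVneq x 0.
  by rewrite /qform !mul0mx mxE mulr_ge0 ?opnorm_ge0 ?sqnorm_ge0.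
have n0 : 0 < norm2 x by rewrite norm2E sqrtr_gt0 sqnorm_gt0.
have nxA : norm2 (x *m A) <= opnorm A * norm2 x.
  rewrite -ler_pdivrMr//; apply: (ub_le_sup (opnorm_ubound A)).
  have nZ c z : 0 <= c -> norm2 (c *: z) = c * norm2 z.
    move=> c0; rewrite !norm2E !sqnormE linearZ /= -scalemxAr -scalemxAl !mxE.
    by rewrite mulrA -expr2 sqrtrM ?sqr_ge0// sqrtr_sqr ger0_norm.
  exists ((norm2 x)^-1 *: x) => /=; last by rewrite -scalemxAl nZ ?invr_ge0 ?(ltW n0)// mulrC.
  by rewrite nZ ?invr_ge0 ?(ltW n0)// mulVf ?gt_eqF.
apply: (@le_trans _ _ (norm2 (x *m A) * norm2 x)).
  rewrite !norm2E -sqrtrM ?sqnorm_ge0//; apply: le_trans (ler_norm _) _.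
  rewrite -sqrtr_sqr ler_wsqrtr//.
  exact: (dot_cauchy_schwarz (x *m A) x).
apply: (le_trans (ler_wpM2r (ltW n0) nxA)).
by rewrite -mulrA -expr2 norm2E sqr_sqrtr ?sqnorm_ge0.
Qed.

Lemma tr_le_opnorm A S : psd A -> \tr (A *m S) <= \tr A * opnorm S.
Proof.
move=> pA; rewrite mulrC -mxtraceZ -mul_mx_scalar -subr_ge0 -linearB /= -mulmxBr.
apply: tr_psd_ge0 => // x.
by rewrite qformD qformN qform_scalar subr_ge0 qform_le_opnorm.
Qed.

Lemma Hnorm_ubound H K x : H = @psd R d `&` K ->
  has_ubound [set Anorm A x | A in [set A | H A /\ \tr A <= 1]].
Proof.
move=> HK; exists (Num.sqrt (sqnorm x)) => _ [A /= [HA trA] <-].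
move: HA; rewrite HK => -[pA _].
rewrite ler_wsqrtr//; apply: (le_trans (qform_le_tr x pA)).
by rewrite ler_piMl// sqnorm_ge0.
Qed.

(** [V / Tr V] competes in the supremum defining [Hnorm]. If [Tr V = 0], the form of [V]
    vanishes. *)
Lemma qform_le_Hnorm H K V x : H = @psd R d `&` K -> matrix_algebra K ->
  K V -> psd V -> Hnorm H x <= 1 -> qform V x <= \tr V.
Proof.
move=> HK [KZ _ _ _] KV pV nx.
have := psd_tr_ge0 pV; rewrite le_eqVlt => /predU1P[tr0|tr_gt0].
  by have := qform_le_tr x pV; rewrite -tr0 mul0r.
have : Anorm ((\tr V)^-1 *: V) x <= Hnorm H x.
  apply: (ub_le_sup (Hnorm_ubound x HK)); exists ((\tr V)^-1 *: V) => //=; split.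
    rewrite HK; split; last exact: KZ.
    split; first by rewrite linearZ /= pV.1.
    by move=> z; rewrite qformZ mulr_ge0 ?invr_ge0 ?pV.2// ltW.
  by rewrite mxtraceZ mulVf// gt_eqF.
move=> /le_trans/(_ nx); rewrite /Anorm -[X in _ <= X]sqrtr1 ler_psqrt ?nnegrE//.
  by rewrite qformZ mulrC ler_pdivrMr// mul1r.
by rewrite qformZ mulr_ge0 ?invr_ge0 ?pV.2// ltW.
Qed.

(** Cauchy-Schwarz in the norm of [V] for [x] and [y V^-1]. The preconditioner [V] is free, so the
    analysis may insert [W_t]. *)
Lemma dot_le_Hnorm H K V x y : H = @psd R d `&` K -> matrix_algebra K ->
  K V -> pd V -> Hnorm H x <= 1 ->
  (x *m y^T) 0 0 <= Num.sqrt (\tr V * qform (invmx V) y).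
Proof.
move=> HK aK KV pV nx; apply: le_trans (ler_norm _) _.
rewrite -sqrtr_sqr ler_wsqrtr// -(bform_invr _ _ pV).
apply: (le_trans (bform_cauchy_schwarz _ _ (pd_psd pV))).
rewrite qform_congr_inv// ler_wpM2r//; last exact: (qform_le_Hnorm HK aK KV (pd_psd pV) nx).
exact: (pd_psd (pd_inv pV)).2.
Qed.

Lemma Hnorm0 H K : H = @psd R d `&` K -> matrix_algebra K -> Hnorm H 0 <= 1.
Proof.
move=> HK aK; apply: ge_sup.
  exists (Anorm (0 : 'M[R]_d) (0 : 'rV[R]_d)); exists 0 => //=; split; last by rewrite linear0 ler01.
  have -> : (0 : 'M[R]_d) = 0%:M by rewrite -scalemx1 scale0r.
  by rewrite HK; split; [exact: psd_scalar|exact: algebra_scalar].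
move=> _ [A _ <-]; rewrite /Anorm /qform !mul0mx mxE sqrtr0//.
Qed.

Lemma pd1 : pd (1%:M : 'M[R]_d).
Proof.
by split=> [|x x0]; rewrite ?tr_scalar_mx// qform_scalar mul1r sqnorm_gt0.
Qed.

Lemma Hdualnorm_le H K V y : H = @psd R d `&` K -> matrix_algebra K ->
  K V -> pd V -> Hdualnorm H y <= Num.sqrt (\tr V * qform (invmx V) y).
Proof.
move=> HK aK KV pV; apply: ge_sup.
  by exists (((0 : 'rV[R]_d) *m y^T) 0 0); exists 0 => //=; exact: Hnorm0 HK aK.
by move=> _ [x /= nx <-]; exact: (dot_le_Hnorm _ HK aK).
Qed.

Lemma Hdualnorm_ubound H K y : H = @psd R d `&` K -> matrix_algebra K ->
  has_ubound [set (x *m y^T) 0 0 | x in [set x | Hnorm H x <= 1]].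
Proof.
move=> HK aK; exists (Num.sqrt (\tr (1%:M : 'M[R]_d) * qform (invmx 1%:M) y)).
move=> _ [x /= nx <-]; apply: (dot_le_Hnorm _ HK aK) => //; last exact: pd1.
exact: algebra_scalar.
Qed.

Lemma Hdualnorm_ge0 H K y : H = @psd R d `&` K -> matrix_algebra K ->
  0 <= Hdualnorm H y.
Proof.
move=> HK aK; apply: (ub_le_sup (Hdualnorm_ubound y HK aK)); exists 0 => /=.
  exact: Hnorm0 HK aK.
by rewrite mul0mx mxE.
Qed.

(** The choice [V = I] gives a Lipschitz bound with constant [sqrt d]; it serves the continuity,
    hence the measurability, of the dual norm. *)
Lemma Hdualnorm_leD H K y z : H = @psd R d `&` K -> matrix_algebra K ->
  Hdualnorm H y <= Hdualnorm H z + Num.sqrt (d%:R * sqnorm (y - z)).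
Proof.
move=> HK aK; apply: ge_sup.
  by exists (((0 : 'rV[R]_d) *m y^T) 0 0); exists 0 => //=; exact: Hnorm0 HK aK.
move=> _ [x /= nx <-]; rewrite -[y in y^T](subrK z) addrC linearD mulmxDr mxE /=.
apply: lerD.
  by apply: (ub_le_sup (Hdualnorm_ubound z HK aK)); exists x.
have := dot_le_Hnorm (y - z) HK aK (algebra_scalar 1 aK) pd1 nx.
by rewrite mxtrace1 invmx1 qform_scalar mul1r.
Qed.

End Norms.

Lemma sqrtrD_le (R : rcfType) (a b : R) : 0 <= a -> 0 <= b ->
  Num.sqrt (a + b) <= Num.sqrt a + Num.sqrt b.
Proof.
move=> a0 b0; rewrite -(@ler_pXn2r _ 2) ?nnegrE ?addr_ge0 ?sqrtr_ge0//.
by rewrite sqrrD !sqr_sqrtr ?addr_ge0// addrAC lerDl mulrn_wge0// mulr_ge0 ?sqrtr_ge0.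
Qed.

Lemma sum_sqrtM_le (R : rcfType) (n : nat) (a b : nat -> R) :
  (forall i, 0 <= a i) -> (forall i, 0 <= b i) ->
  \sum_(i < n) Num.sqrt (a i * b i) <= Num.sqrt ((\sum_(i < n) a i) * (\sum_(i < n) b i)).
Proof.
move=> a0 b0; elim: n => [|n IH]; first by rewrite !big_ord0 mul0r sqrtr0.
rewrite !big_ord_recr /=; apply: (le_trans (lerD IH (lexx _))).
set A := \sum_(i < n) a i; set B := \sum_(i < n) b i.
have A0 : 0 <= A by apply: sumr_ge0.
have B0 : 0 <= B by apply: sumr_ge0.
set u := a n; set v := b n.
have [u0 v0] : 0 <= u /\ 0 <= v by split; [exact: a0|exact: b0].
rewrite -(@ler_pXn2r _ 2) ?nnegrE ?addr_ge0 ?sqrtr_ge0//.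
rewrite sqr_sqrtr ?mulr_ge0 ?addr_ge0// sqrrD !sqr_sqrtr ?mulr_ge0//.
rewrite -(sqrtrM _ (mulr_ge0 A0 B0)).
(* Regrouped so that the mixed term is bounded by [A v + u B] through the arithmetic-geometric mean
   inequality. *)
have -> : A * B * (u * v) = (A * v) * (u * B) by ring.
rewrite sqrtrM ?mulr_ge0//.
have [p0 q0] := (sqr_sqrtr (mulr_ge0 A0 v0), sqr_sqrtr (mulr_ge0 u0 B0)).
have := sqr_ge0 (Num.sqrt (A * v) - Num.sqrt (u * B)); rewrite sqrrB p0 q0.
lra.
Qed.

Lemma sum_geometricS (R : pzRingType) (s : R) (k : nat) :
  \sum_(i < k.+1) s ^+ i = 1 + s * \sum_(i < k) s ^+ i.
Proof.
elim: k => [|k IHk]; first by rewrite big_ord1 big_ord0 expr0 mulr0 addr0.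
by rewrite big_ord_recr /= {1}IHk [in RHS]big_ord_recr /= mulrDr -exprS addrA.
Qed.

(** Since [a 0 = 0], summing the recursion bounds each partial sum by [s] times the previous one
    plus a partial sum of [r]; the latter are nondecreasing, so the powers of [s] factor out. *)
Lemma sum_geometric_recursion (R : realDomainType) (s : R) (n : nat) (a r : nat -> R) :
  0 <= s -> (forall t, 0 <= r t) -> a 0 = 0 ->
  (forall t, (t < n)%N -> a t.+1 <= s * a t + r t) ->
  \sum_(t < n) a t.+1 <= (\sum_(i < n) s ^+ i) * \sum_(t < n) r t.
Proof.
move=> s0 r0 a0 rec.
suff H m : (m <= n)%N -> \sum_(t < m) a t.+1 <= (\sum_(i < m) s ^+ i) * \sum_(t < m) r t.
  exact: H.
elim: m => [|m IH] mn; first by rewrite !big_ord0 mul0r.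
have {}IH := IH (ltnW mn).
have step : \sum_(t < m.+1) a t.+1 <= s * (\sum_(t < m) a t.+1) + \sum_(t < m.+1) r t.
  have -> : \sum_(t < m) a t.+1 = \sum_(t < m.+1) a t by rewrite big_ord_recl a0 add0r.
  rewrite mulr_sumr -big_split /=; apply: ler_sum => t _; apply: rec.
  exact: leq_trans (ltn_ord t) mn.
apply: (le_trans step); rewrite sum_geometricS mulrDl mul1r addrC lerD2l -mulrA ler_wpM2l//.
apply: (le_trans IH).
rewrite ler_wpM2l//; first by apply: sumr_ge0 => i _; exact: exprn_ge0.
by rewrite [leRHS]big_ord_recr /= lerDl.
Qed.

(** * The descent lemma *)

Section Descent.
Context {R : realType} {d : nat}.
Implicit Types (A : 'M[R]_d) (x v y : 'rV[R]_d) (f g : 'rV[R]_d -> R) (t : R).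

Lemma derive_line g x v t : differentiable g (x + t *: v) ->
  is_derive t (1 : R) (fun s : R => g (x + s *: v)) ('d g (x + t *: v) v).
Proof.
move=> dg; have dv : derivable g (x + t *: v) v by exact: diff_derivable.
have E : (fun h : R => h^-1 *: (((fun s : R => g (x + s *: v)) \o shift t) (h *: (1 : R))
      - g (x + t *: v)))
    = (fun h : R => h^-1 *: ((g \o shift (x + t *: v)) (h *: v) - g (x + t *: v))).
  apply/funext => h /=; congr (_ *: (g _ - _)).
  by rewrite scalerDl [h *: 1]mulr1 addrCA.
split; first by rewrite /derivable E.
by rewrite -deriveE// /derive E.
Qed.

Lemma diff_grad g x v : differentiable g x -> 'd g x v = (v *m (grad g x)^T) 0 0.
Proof.
move=> dg; rewrite {1}(row_sum_delta v) linear_sum dotE /=.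
apply: eq_bigr => i _; rewrite linearZ /= -[in LHS]deriveE// !mxE.
by rewrite /GRing.scale/=.
Qed.

Lemma is_derive_line g x v t : differentiable g (x + t *: v) ->
  is_derive t (1 : R) (fun s : R => g (x + s *: v))
    ((v *m (grad g (x + t *: v))^T) 0 0).
Proof. by move=> dg; rewrite -diff_grad//; exact: derive_line. Qed.

Lemma is_derive_grad_line f x v t : C2 f ->
  is_derive t (1 : R) (fun s : R => (v *m (grad f (x + s *: v))^T) 0 0)
    (qform (hessian f (x + t *: v)) v).
Proof.
move=> [_ dp _].
have -> : (fun s : R => (v *m (grad f (x + s *: v))^T) 0 0)
   = \sum_i (fun s : R => v 0 i * partial i f (x + s *: v)).
  by apply/funext => s; rewrite fct_sumE dotE; apply: eq_bigr => i _; rewrite !mxE.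
have -> : qform (hessian f (x + t *: v)) v
   = \sum_i v 0 i * (v *m (grad (partial i f) (x + t *: v))^T) 0 0.
  rewrite /qform -mulmxA mxE; apply: eq_bigr => i _; congr (_ * _).
  rewrite dotE mxE; apply: eq_bigr => j _; rewrite !mxE mulrC//.
apply: is_derive_sum => i.
apply: is_deriveZ.
exact: is_derive_line.
Qed.

(** Two mean value arguments along the segment: the first bounds the slope by
    [phi' 0 + qform A v * s], the second shows that [phi] minus the corresponding parabola does not
    increase. *)
Lemma descent_lemma f A x v : C2 f ->
  (forall y, loewner (hessian f y) A) ->
  f (x + v) <= f x + (v *m (grad f x)^T) 0 0 + qform A v / 2.
Proof.
move=> C2f fA; have [df _ _] := C2f.
pose phi (s : R) : R := f (x + s *: v).
pose phi' (s : R) : R := (v *m (grad f (x + s *: v))^T) 0 0.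
have Dphi s : is_derive s (1 : R) phi (phi' s) by exact: is_derive_line.
have Dphi' s : is_derive s (1 : R) phi' (qform (hessian f (x + s *: v)) v).
  exact: is_derive_grad_line.
have hessA s : qform (hessian f (x + s *: v)) v <= qform A v.
  by have [_ /(_ v)] := fA (x + s *: v); rewrite qformD qformN subr_ge0.
have phi'_le s : 0 < s -> phi' s <= phi' 0 + qform A v * s.
  move=> s0.
  have cphi' : {within `[0, s], continuous phi'}.
    apply: continuous_subspaceT => r.
    exact/differentiable_continuous/derivable1_diffP/ex_derive.
  have [c _] := MVT s0 (fun r _ => Dphi' r) cphi'.
  rewrite subr0 => E; rewrite -lerBlDl E ler_wpM2r//; exact: ltW.
pose psi (s : R) : R := phi s - (phi' 0 * s + qform A v / 2 * s ^+ 2).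
have Dpsi s : is_derive s (1 : R) psi (phi' s - (phi' 0 + qform A v * s)).
  have D1 : is_derive s (1 : R) (phi' 0 \*: @id R) (phi' 0 *: 1) by exact: is_deriveZ.
  have D2 : is_derive s (1 : R) ((qform A v / 2) \*: (@id R ^+ 2))
      ((qform A v / 2) *: ((2 * s ^+ 1) *: 1)).
    by apply: is_deriveZ; apply: (@is_deriveX _ _ (@id R) 2 s 1 1).
  have -> : psi = phi - (phi' 0 \*: @id R + (qform A v / 2) \*: (@id R ^+ 2)) by [].
  have -> : phi' s - (phi' 0 + qform A v * s) =
      phi' s - (phi' 0 *: 1 + (qform A v / 2) *: ((2 * s ^+ 1) *: 1)).
    by rewrite /GRing.scale /= expr1; field.
  exact: is_deriveB.
have cpsi : {within `[0, 1], continuous psi}.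
  apply: continuous_subspaceT => r.
  exact/differentiable_continuous/derivable1_diffP/ex_derive.
have [c] := MVT ltr01 (fun r _ => Dpsi r) cpsi.
rewrite in_itv /= => /andP[c0 _]; rewrite subr0 mulr1 => E.
have := phi'_le c c0; rewrite -subr_le0 -E /psi.
rewrite mulr0 expr0n mulr0 addr0 subr0 expr1n !mulr1 /phi /phi' scale1r scale0r addr0.
lra.
Qed.

End Descent.

(** * Pathwise analysis of the algorithm *)

(** The factor 2: [s], the form of [Sigma], enters once through the comparison of the gradients and
    once as the summand [Sigma] of the lookahead matrix. *)
Lemma noise_arith (R : realFieldType) (a b c e s k : R) :
  c <= b + s -> s <= e -> a + (c + s) + k <= a + b + k + 2 * e.
Proof. by move=> *; lra. Qed.

Lemma descent_arith (R : realFieldType) (eta c u w v F0 F1 F2 k a b a' b' : R) :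
  eta * u <= F0 - F1 + k * a + eta * (c * b) -> F2 <= F1 - eta * v + k * a' ->
  eta * (w - c * b') <= eta * v ->
  eta * (u + w) <= F0 - F2 + k * (a + a') + eta * (c * (b + b')).
Proof. by move=> *; lra. Qed.

Section Algorithm.
Context {R : realType} {d : nat}.
Implicit Types (A V W : 'M[R]_d) (x y z : 'rV[R]_d).
Variables (H K : set 'M[R]_d) (eps beta eta : R) (x0 : 'rV[R]_d).
Variables (f : 'rV[R]_d -> R) (Sigma : 'M[R]_d).

Section Definitions.
Variable G : nat -> 'rV[R]_d -> 'rV[R]_d.

Definition ada_Mprev (t : nat) : 'M[R]_d := (ada_state H eps beta eta x0 G t).2.

(* The analysis compares [V_t] with this preconditioner, which does not depend on
   the noise at time [t] and dominates every possible value of [V_t]. *)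
Definition lookahead_V (t : nat) : 'M[R]_d :=
  let h := grad f (ada_x H eps beta eta x0 G t) in
  PH H (beta *: ada_Mprev t + (h^T *m h + Sigma) + eps%:M).

Definition stationarity (t : nat) : R :=
  qform (invmx (lookahead_V t)) (grad f (ada_x H eps beta eta x0 G t)).

(** The noise bound at the iterate of one trajectory, a deterministic condition that separates the
    pathwise analysis from probability. *)
Definition bounded_noise (t : nat) : Prop :=
  let x := ada_x H eps beta eta x0 G t in
  forall z, qform ((G t x)^T *m G t x) z <= qform ((grad f x)^T *m grad f x) z + qform Sigma z
         /\ qform ((grad f x)^T *m grad f x) z <= qform ((G t x)^T *m G t x) z + qform Sigma z.

(** The counterpart of [ada_Mprev] with true gradients, taken along the same noisy trajectory. *)
Fixpoint gram_grad (t : nat) : 'M[R]_d :=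
  if t is t'.+1 then
    let h := grad f (ada_x H eps beta eta x0 G t') in
    beta *: gram_grad t' + h^T *m h
  else 0.

End Definitions.

Hypotheses (aK : matrix_algebra K) (HK : H = @psd R d `&` K).
Hypotheses (eps_gt0 : 0 < eps) (beta01 : 0 < beta <= 1) (eta_gt0 : 0 < eta).
Hypothesis psdS : psd Sigma.
Variable G : nat -> 'rV[R]_d -> 'rV[R]_d.

Local Notation x := (ada_x H eps beta eta x0 G).
Local Notation Mp := (ada_Mprev G).
Local Notation M := (ada_M H eps beta eta x0 G).
Local Notation V := (ada_V H eps beta eta x0 G).
Local Notation S := (ada_S_term H eps beta eta x0 G).
Local Notation W := (lookahead_V G).
Local Notation r := (stationarity G).
Local Notation g t := (G t (x t)).
Local Notation h t := (grad f (x t)).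

Let beta_ge0 : 0 <= beta. Proof. by case/andP: beta01 => /ltW. Qed.

Lemma ada_MprevS t : Mp t.+1 = M t.
Proof. by rewrite /ada_Mprev /ada_M /ada_x /=; case: (ada_state _ _ _ _ _ _ t). Qed.

Lemma ada_Mprev0 : Mp 0 = 0. Proof. by []. Qed.

Lemma ada_x0 : x 0 = x0. Proof. by []. Qed.

Lemma ada_xS t : x t.+1 = x t - eta *: (g t *m invmx (V t)).
Proof. by rewrite /ada_V /ada_M /ada_x /=; case: (ada_state _ _ _ _ _ _ t). Qed.

#[local] Opaque PH ada_state.

Lemma ada_Mprev_ge0 t z : 0 <= qform (Mp t) z.
Proof.
elim: t z => [|t IH] z; first by rewrite ada_Mprev0 qform0.
by rewrite ada_MprevS qformD qformZ addr_ge0 ?mulr_ge0// qform_outer sqr_ge0.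
Qed.

Lemma qform_shift_gt0 N z : (forall y, 0 <= qform N y) -> z != 0 ->
  0 < qform (N + eps%:M) z.
Proof.
by move=> N0 z0; rewrite qformD qform_scalar ltr_wpDl// mulr_gt0// sqnorm_gt0.
Qed.

Lemma PH_sqrt N : (forall y, 0 <= qform N y) ->
  algebra_sqrt K (N + eps%:M) (PH H (N + eps%:M)).
Proof. by move=> N0; apply: PH_algebra_sqrt => // z; exact: qform_shift_gt0. Qed.

Lemma ada_V_sqrt t : algebra_sqrt K (M t + eps%:M) (V t).
Proof.
apply: PH_sqrt => y.
by rewrite qformD qformZ addr_ge0 ?mulr_ge0 ?ada_Mprev_ge0// qform_outer sqr_ge0.
Qed.

Lemma lookahead_V_sqrt t : algebra_sqrt K
  (beta *: Mp t + ((h t)^T *m h t + Sigma) + eps%:M) (W t).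
Proof.
apply: PH_sqrt => y; rewrite !qformD qformZ.
by rewrite !addr_ge0 ?mulr_ge0 ?ada_Mprev_ge0 ?psdS.2// qform_outer sqr_ge0.
Qed.

Lemma stationarity_ge0 t : 0 <= r t.
Proof. by case: (lookahead_V_sqrt t) => _ /pd_inv/pd_psd[_ +] _; exact. Qed.

(** Against [V^-1 A V^-1], a symmetric element of [K], the matrix [V_t^2 - beta V_{t-1}^2] may be
    exchanged for its unprojected version [g^T g + (1 - beta) eps I], whose second term only adds to
    the trace. *)
Lemma qform_le_S_term A t : K A -> psd A ->
  qform A (g t *m invmx (V t)) <= \tr (A *m S t).
Proof.
move=> KA pA; have [KV pV VP] := ada_V_sqrt t.
have [KZ KD KM K1] := aK.
have KI : K (invmx (V t)) by exact: algebra_inv.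
have sI : (invmx (V t))^T = invmx (V t) by rewrite invmx_sym ?pV.1.
pose B := invmx (V t) *m A *m invmx (V t).
have KB : K B by exact: (KM _ _ (KM _ _ KI KA) KI).
have pB : psd B.
  split; first by rewrite /B !trmx_mul sI pA.1 mulmxA.
  by move=> z; rewrite qform_congr// pA.2.
have -> : \tr (A *m S t) = \tr ((V t *m V t - beta *: ada_Vprev_sq H eps beta eta x0 G t) *m B).
  by rewrite /ada_S_term mxtrace_mulC -!mulmxA mxtrace_mulC /B -!mulmxA.
have -> : \tr ((V t *m V t - beta *: ada_Vprev_sq H eps beta eta x0 G t) *m B)
    = \tr ((M t + eps%:M - beta *: (Mp t + eps%:M)) *m B).
  rewrite !mulmxBl !linearB /= -VP//; last exact: pB.1.
  congr (_ - _); rewrite -!scalemxAl !mxtraceZ; congr (_ * _).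
  (* At [t = 0] the convention [V_{-1}^2 = eps I] matches [M_{-1} = 0]. *)
  case: t {VP KV pV KI sI} @B KB pB => [|t] B KB pB; first by rewrite ada_Mprev0 add0r.
  by have [_ _ VP] := ada_V_sqrt t; rewrite ada_MprevS VP// pB.1.
have -> : M t + eps%:M - beta *: (Mp t + eps%:M) = (g t)^T *m g t + ((1 - beta) * eps)%:M.
  rewrite /ada_M -/(Mp t) scalerDr scale_scalar_mx mulrBl mul1r raddfB /=.
  rewrite opprD addrACA [beta *: _ + _]addrC addrK addrA; congr (_ + _).
rewrite mulmxDl mxtraceD -(qform_congr _ _ sI) -/B qform_tr mxtrace_mulC lerDl.
rewrite mul_scalar_mx mxtraceZ !mulr_ge0 ?(ltW eps_gt0) ?psd_tr_ge0// subr_ge0.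
by case/andP: beta01.
Qed.

Lemma sqnorm_le_S_term t : sqnorm (g t *m invmx (V t)) <= \tr (S t).
Proof.
have := @qform_le_S_term 1%:M t (algebra_scalar 1 aK) (psd_scalar ler01).
by rewrite qform_scalar !mul1r mul1mx.
Qed.

(** The perturbation bound for [V_t <= W_t <= V_t + sqrt (2 |Sigma|) I]; the leftover
    [|g_t V_t^-1|^2] is charged to [Tr S_t]. *)
Lemma ada_cross_term t : bounded_noise G t ->
  bform (invmx (W t)) (h t) (g t) - r t / 2
    - Num.sqrt (2 * opnorm Sigma) / 2 * \tr (S t)
  <= bform (invmx (V t)) (h t) (g t).
Proof.
move=> noise.
have [[KV pV VP] [KW pW WP]] := (ada_V_sqrt t, lookahead_V_sqrt t).
have VW := algebra_sqrt_mono aK (ada_V_sqrt t) (lookahead_V_sqrt t).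
have s0 : 0 <= 2 * opnorm Sigma by rewrite mulr_ge0// opnorm_ge0.
have WV := algebra_sqrt_le aK s0 (lookahead_V_sqrt t) (ada_V_sqrt t).
have := @bform_inv_perturb _ _ (V t) (W t) (Num.sqrt (2 * opnorm Sigma)) (g t) (h t) pV pW _ _.
move=> E; apply: le_trans (E _ _).
- rewrite lerD2l lerN2 ler_wpM2l ?divr_ge0 ?sqrtr_ge0//; exact: sqnorm_le_S_term.
- apply: VW => z; have [n1 _] := noise z.
  by rewrite /ada_M !qformD lerD2r lerD2l.
- apply: WV => z; have [_ n2] := noise z.
  rewrite /ada_M -/(Mp t) !qformD -mulrA; apply: noise_arith n2 _.
  exact: qform_le_opnorm.
Qed.

(** As [A] lies in [K], the quadratic term of the descent lemma can be charged to [S_t]. *)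
Lemma ada_descent A t : H A -> C2 f -> (forall y, loewner (hessian f y) A) ->
  f (x t.+1) <= f (x t) - eta * bform (invmx (V t)) (h t) (g t)
     + eta ^+ 2 / 2 * \tr (A *m S t).
Proof.
rewrite {1}HK => -[pA KA] C2f fA; have [KV pV VP] := ada_V_sqrt t.
have := descent_lemma (x t) (- eta *: (g t *m invmx (V t))) C2f fA.
rewrite scaleNr -ada_xS => /le_trans; apply.
rewrite -scaleNr -scalemxAl mxE -[X in _ + (- eta) * X + _]/(bform (invmx (V t)) (g t) (h t)).
rewrite (bform_sym _ _ (invmx_sym pV.1)) !qformE bformZl bformZr -qformE.
rewrite mulNr lerD2l mulrA mulrNN -expr2 -mulrA [_ / 2]mulrC mulrA ler_wpM2l//.
  by rewrite divr_ge0// sqr_ge0.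
exact: qform_le_S_term.
Qed.

Lemma ada_descent_sum A m T : H A -> C2 f -> (forall y, loewner (hessian f y) A) ->
  (forall y, m <= f y) -> (forall t, (t < T)%N -> bounded_noise G t) ->
  \sum_(t < T) (bform (invmx (W t)) (h t) (g t) - r t / 2) <=
  (f x0 - m) / eta + eta / 2 * \tr (A *m \sum_(t < T) S t)
   + Num.sqrt (2 * opnorm Sigma) / 2 * \tr (\sum_(t < T) S t).
Proof.
move=> HA C2f fA mf noise.
set c := Num.sqrt (2 * opnorm Sigma) / 2.
have : eta * \sum_(t < T) (bform (invmx (W t)) (h t) (g t) - r t / 2) <=
  f x0 - f (x T) + eta ^+ 2 / 2 * \tr (A *m \sum_(t < T) S t)
   + eta * (c * \tr (\sum_(t < T) S t)).
  elim: T noise => [|T IH] noise.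
    by rewrite !big_ord0 mulmx0 !linear0 !mulr0 ada_x0 subrr !addr0.
  have {}IH := IH (fun t tT => noise t (leqW tT)).
  rewrite !big_ord_recr /= mulmxDr !mxtraceD.
  have D := ada_descent T HA C2f fA.
  have C : eta * (bform (invmx (W T)) (h T) (g T) - r T / 2 - c * \tr (S T))
     <= eta * bform (invmx (V T)) (h T) (g T).
    by rewrite ler_wpM2l ?(ltW eta_gt0)//; exact: ada_cross_term (noise T (ltnSn T)).
  exact: descent_arith IH D C.
move=> E; rewrite -(ler_pM2l eta_gt0) (le_trans E)// !mulrDr lerD2r.
have -> : eta * ((f x0 - m) / eta) = f x0 - m by field; rewrite gt_eqF.
have -> : eta * (eta / 2 * \tr (A *m \sum_(t < T) S t)) =
   eta ^+ 2 / 2 * \tr (A *m \sum_(t < T) S t) by field.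
by rewrite lerD2r lerD2l lerN2.
Qed.

Lemma gram_grad_ge0 t z : 0 <= qform (gram_grad G t) z.
Proof.
elim: t z => [|t IH] z /=; first by rewrite qform0.
by rewrite qformD qformZ addr_ge0 ?mulr_ge0// qform_outer sqr_ge0.
Qed.

Lemma ada_Mprev_le t z : (forall s, (s < t)%N -> bounded_noise G s) ->
  qform (Mp t) z <= qform (gram_grad G t) z + (\sum_(i < t) beta ^+ i) * qform Sigma z.
Proof.
elim: t => [|t IH] noise; first by rewrite big_ord0 ada_Mprev0 qform0 mul0r addr0.
have {}IH := IH (fun s st => noise s (leqW st)).
have [n1 _] := noise t (ltnSn t) z.
rewrite ada_MprevS /ada_M -/(Mp t) /= !qformD !qformZ.
have -> : \sum_(i < t.+1) beta ^+ i = 1 + beta * \sum_(i < t) beta ^+ i.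
  exact: sum_geometricS.
have := ler_wpM2l beta_ge0 IH; rewrite mulrDr; move: n1; rewrite /=; lra.
Qed.

(** All the noise up to time [T] is put at once into the fixed matrix [B], so [U 0] is the noise
    level [p]. The excess [a t = Tr (U t) - Tr p] shrinks by [sqrt beta] under discounting and grows
    by at most [r t] when the new gradient is added. *)
Lemma lookahead_tr_sum T : (forall t, (t < T)%N -> bounded_noise G t) ->
  \sum_(t < T) \tr (W t) <=
  (\sum_(i < T) Num.sqrt beta ^+ i) * (\sum_(t < T) r t)
  + T%:R * \tr (PH H ((\sum_(i < T) beta ^+ i) *: Sigma + eps%:M)).
Proof.
move=> noise.
set b := \sum_(i < T) beta ^+ i.
have b0 : 0 <= b by apply: sumr_ge0 => i _; exact: exprn_ge0.
pose B := b *: Sigma.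
have B0 z : 0 <= qform B z by rewrite qformZ mulr_ge0// psdS.2.
set p := PH H (b *: Sigma + eps%:M).
have sp : algebra_sqrt K (B + eps%:M) p by exact: PH_sqrt.
pose U t := PH H (gram_grad G t + B + eps%:M).
have sU t : algebra_sqrt K (gram_grad G t + B + eps%:M) (U t).
  by apply: PH_sqrt => z; rewrite qformD addr_ge0// gram_grad_ge0.
pose Y t := PH H (beta *: gram_grad G t + B + eps%:M).
have sY t : algebra_sqrt K (beta *: gram_grad G t + B + eps%:M) (Y t).
  apply: PH_sqrt => z.
  by rewrite qformD qformZ addr_ge0// mulr_ge0// gram_grad_ge0.
have sbeta01 : 0 <= Num.sqrt beta <= 1.
  by rewrite sqrtr_ge0 -[X in _ <= X]sqrtr1 ler_wsqrtr//; case/andP: beta01.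
have YU t : \tr (Y t) <= \tr p + Num.sqrt beta * (\tr (U t) - \tr p).
  apply: (algebra_sqrt_tr_convex aK sbeta01 sp (Q := gram_grad G t)).
  - by rewrite addrA; exact: sU.
  - by rewrite (sqr_sqrtr beta_ge0) addrA; exact: sY.
  - exact: gram_grad_ge0.
have WU t : (t < T)%N -> forall z, qform (W t) z <= qform (U t.+1) z.
  move=> tT; apply: (algebra_sqrt_mono aK (lookahead_V_sqrt t) (sU t.+1)) => z.
  rewrite !qformD !(qformZ beta) lerD2r.
  have := ler_wpM2l beta_ge0 (ada_Mprev_le z (fun s st => noise s (ltn_trans st tT))).
  (* The past carries [t] discounted copies of [Sigma] and the lookahead one more: a geometric sum
     of [t + 1 <= T] terms. *)
  have : (1 + beta * \sum_(i < t) beta ^+ i) * qform Sigma z <= qform B z.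
    rewrite -sum_geometricS qformZ ler_wpM2r ?psdS.2// /b.
    rewrite -(big_mkord xpredT (fun i => beta ^+ i)) -[leRHS](big_mkord xpredT (fun i => beta ^+ i)).
    rewrite [leRHS](big_cat_nat _ (n := t.+1))//= lerDl sumr_ge0// => i _.
    exact: exprn_ge0.
  rewrite mulrDl mul1r mulrDr; lra.
have rU t : (t < T)%N -> \tr (U t.+1) - \tr (Y t) <= r t.
  move=> tT; have [_ pW _] := lookahead_V_sqrt t; have [_ pU _] := sU t.+1.
  (* The rank-one bound is in the norm of [U_{t+1}^-1], which [W_t <= U_{t+1}] places below that of
     [W_t^-1]. *)
  apply: le_trans (qform_inv_anti (h t) pW pU (WU t tT)).
  apply: (algebra_sqrt_rank1_drop aK (sY t)).
  by have := sU t.+1; rewrite /= -!addrA [(h t)^T *m h t + _]addrC !addrA.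
have sb0 := sqrtr_ge0 beta.
pose a t := \tr (U t) - \tr p.
have a0 : a 0 = 0 by rewrite /a /U /= add0r subrr.
have rec t : (t < T)%N -> a t.+1 <= Num.sqrt beta * a t + r t.
  by move=> tT; have := rU t tT; have := YU t; rewrite /a; lra.
have := sum_geometric_recursion sb0 stationarity_ge0 a0 rec.
have : \sum_(t < T) \tr (W t) <= \sum_(t < T) (a t.+1 + \tr p).
  apply: ler_sum => t _; rewrite /a subrK; apply: tr_qform_le; exact: WU.
rewrite big_split /= sumr_const card_ord -mulr_natl; lra.
Qed.

Lemma Hdualnorm_sum T : (forall t, (t < T)%N -> bounded_noise G t) ->
  \sum_(t < T) Hdualnorm H (h t) <=
  Num.sqrt (\sum_(i < T) Num.sqrt beta ^+ i) * (\sum_(t < T) r t)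
  + Num.sqrt (T%:R * \tr (PH H ((\sum_(i < T) beta ^+ i) *: Sigma + eps%:M))) * Num.sqrt (\sum_(t < T) r t).
Proof.
move=> noise; set rho := \sum_(t < T) r t.
have rho0 : 0 <= rho by apply: sumr_ge0 => t _; exact: stationarity_ge0.
have trW t : 0 <= \tr (W t).
  by have [_ pW _] := lookahead_V_sqrt t; exact/psd_tr_ge0/pd_psd.
apply: (@le_trans _ _ (\sum_(t < T) Num.sqrt (\tr (W t) * r t))).
  apply: ler_sum => t _; have [KW pW _] := lookahead_V_sqrt t.
  exact: (Hdualnorm_le _ HK aK).
apply: (le_trans (sum_sqrtM_le T trW stationarity_ge0)); rewrite -/rho.
set c := \sum_(i < T) Num.sqrt beta ^+ i.
have c0 : 0 <= c by apply: sumr_ge0 => i _; rewrite exprn_ge0// sqrtr_ge0.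
set q := _ * \tr (PH _ _).
have q0 : 0 <= q.
  rewrite mulr_ge0//; apply/psd_tr_ge0/pd_psd.
  have [] // := @PH_sqrt ((\sum_(i < T) beta ^+ i) *: Sigma) _ => z.
  rewrite qformZ mulr_ge0 ?psdS.2// sumr_ge0// => i _; exact: exprn_ge0.
have E := lookahead_tr_sum noise; rewrite -/c -/rho -/q in E.
apply: (@le_trans _ _ (Num.sqrt ((c * rho + q) * rho))).
  by rewrite ler_wsqrtr// ler_wpM2r.
have -> : Num.sqrt c * rho = Num.sqrt (c * rho) * Num.sqrt rho.
  by rewrite sqrtrM// -mulrA -expr2 sqr_sqrtr.
rewrite (sqrtrM rho (addr_ge0 (mulr_ge0 c0 rho0) q0)) -mulrDl ler_wpM2r ?sqrtr_ge0//.
by apply: sqrtrD_le => //; exact: mulr_ge0.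
Qed.

(** The bound ignores the size of the gradient, so it holds on the whole sample space and confines
    each iterate to a deterministic box. *)
Lemma ada_step_bounded t : sqnorm (g t *m invmx (V t)) <= d%:R.
Proof.
apply: (sqnorm_algebra_sqrt_inv_le aK (ada_V_sqrt t)) => z.
rewrite /ada_M -/(Mp t) !qformD qform_scalar qformZ.
have := mulr_ge0 beta_ge0 (ada_Mprev_ge0 t z).
have := mulr_ge0 (ltW eps_gt0) (sqnorm_ge0 z); lra.
Qed.

Lemma lookahead_step_bounded t : sqnorm (h t *m invmx (W t)) <= d%:R.
Proof.
apply: (sqnorm_algebra_sqrt_inv_le aK (lookahead_V_sqrt t)) => z.
rewrite !qformD qform_scalar qformZ.
have := mulr_ge0 beta_ge0 (ada_Mprev_ge0 t z); have := psdS.2 z.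
have := mulr_ge0 (ltW eps_gt0) (sqnorm_ge0 z); lra.
Qed.

End Algorithm.

(** * Measurability of the iterates *)

Section Measurability.
Context {R : realType} {dd : measure_display} {T : measurableType dd}.

Definition mx_measurable (m n : nat) (X : T -> 'M[R]_(m, n)) : Prop :=
  forall i j, measurable_fun setT (fun w => X w i j).

Definition grid (m n : nat) (k : nat) (x : 'M[R]_(m, n)) : 'M[int]_(m, n) :=
  \matrix_(i, j) Num.floor (k.+1%:R * x i j).

Definition ungrid (m n : nat) (k : nat) (z : 'M[int]_(m, n)) : 'M[R]_(m, n) :=
  k.+1%:R^-1 *: map_mx intr z.

Lemma grid_dist (m n k : nat) (x : 'M[R]_(m, n)) : `|x - ungrid k (grid k x)| <= k.+1%:R^-1.
Proof.
rewrite /Num.norm /= mx_normrE; apply/bigmax_leP; split => [|[i j] _] /=; first by rewrite invr_ge0.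
rewrite !mxE /=.
have k0 : 0 < k.+1%:R :> R by rewrite ltr0n.
have -> : x i j - k.+1%:R^-1 * (Num.floor (k.+1%:R * x i j))%:~R
  = k.+1%:R^-1 * (k.+1%:R * x i j - (Num.floor (k.+1%:R * x i j))%:~R).
  by rewrite mulrBr mulKf// gt_eqF.
have i0 : 0 <= k.+1%:R^-1 :> R by rewrite invr_ge0 ltW.
rewrite normrM (ger0_norm i0) ler_piMr//.
have := Num.Theory.floor_le (k.+1%:R * x i j); have := floorD1_gt (k.+1%:R * x i j).
rewrite intrD => h1 h2; rewrite ger0_norm ?subr_ge0// lerBlDl ltW//.
Qed.

Lemma grid_cvg (m n : nat) (x : 'M[R]_(m, n)) : ungrid k (grid k x) @[k --> \oo] --> x.
Proof.
apply/cvgrPdist_le => e e0.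
near=> k; apply: (le_trans (grid_dist k x)).
near: k.
have /cvgrPdist_le/(_ e e0) := @cvg_harmonic R; apply: filterS => k /=.
by rewrite sub0r normrN ger0_norm.
Unshelve. all: by end_near. Qed.

Lemma grid_measurable (m n k : nat) (X : T -> 'M[R]_(m, n)) (z : 'M[int]_(m, n)) :
  mx_measurable X -> measurable [set w | grid k (X w) = z].
Proof.
move=> mX.
have -> : [set w | grid k (X w) = z] =
  \bigcap_(p in [set: 'I_m * 'I_n]) ((fun w => k.+1%:R * X w p.1 p.2) @^-1`
     [set` `[(z p.1 p.2)%:~R, (z p.1 p.2 + 1)%:~R[ ]).
  apply/seteqP; split => w /=.
    move=> <- [i j] _ /=; rewrite in_itv /= mxE.
    by rewrite floor_le floorD1_gt.
  move=> H; apply/matrixP => i j; have := H (i, j) I; rewrite /= in_itv /= mxE.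
  by move=> ?; exact: floor_def.
apply: fin_bigcap_measurable => //.
move=> [i j] _ /=; rewrite -[X in measurable X]setTI.
have : measurable_fun setT (fun w => k.+1%:R * X w i j).
  by apply: measurable_funM => //; exact: mX.
by apply => //.
Qed.

(* A Caratheodory function of a random matrix is measurable: round the matrix to a
   grid, which makes it take countably many values, and refine the grid. *)
Lemma caratheodory_measurable (m n : nat) (X : T -> 'M[R]_(m, n))
    (Phi : T -> 'M[R]_(m, n) -> R) :
  mx_measurable X -> (forall x, measurable_fun setT (Phi^~ x)) ->
  (forall w, {for X w, continuous (Phi w)}) ->
  measurable_fun setT (fun w => Phi w (X w)).
Proof.
move=> mX mPhi cPhi.
apply: (@measurable_fun_cvg _ _ _ _ (fun k w => Phi w (ungrid k (grid k (X w))))); last first.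
  move=> w _; apply: (@cvg_comp _ _ _ (fun k => ungrid k (grid k (X w))) (Phi w)).
    exact: grid_cvg.
  exact: cPhi.
move=> k _ B mB; rewrite setTI.
rewrite (_ : _ @^-1` B = \bigcup_(c in [set: nat])
  (if @unpickle 'M[int]_(m, n) c is Some z then
    [set w | grid k (X w) = z] `&` ((Phi^~ (ungrid k z)) @^-1` B) else set0)).
  apply: bigcup_measurable => c _; case: unpickle => // z.
  apply: measurableI; first exact: grid_measurable.
  by rewrite -[X in measurable X]setTI; exact: mPhi.
apply/seteqP; split => w /=.
  by move=> Bw; exists (pickle (grid k (X w))) => //; rewrite pickleK.
by move=> [c _]; case: unpickle => // z [<-].
Qed.

Lemma continuous_mx_measurable (m n : nat) (X : T -> 'M[R]_(m, n)) (phi : 'M[R]_(m, n) -> R) :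
  mx_measurable X -> (forall w, {for X w, continuous phi}) ->
  measurable_fun setT (fun w => phi (X w)).
Proof. by move=> mX c; apply: (caratheodory_measurable mX (Phi := fun=> phi)). Qed.

Lemma mx_measurable_cst (m n : nat) (A : 'M[R]_(m, n)) : mx_measurable (fun=> A).
Proof. by move=> i j; exact: measurable_cst. Qed.

Lemma mx_measurableD (m n : nat) (X Y : T -> 'M[R]_(m, n)) :
  mx_measurable X -> mx_measurable Y -> mx_measurable (fun w => X w + Y w).
Proof.
move=> mX mY i j; rewrite (_ : (fun w => _) = (fun w => X w i j) \+ (fun w => Y w i j)).
  by apply: measurable_funD; [exact: mX|exact: mY].
by apply/funext => w; rewrite mxE.
Qed.

Lemma mx_measurableZ (m n : nat) a (X : T -> 'M[R]_(m, n)) :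
  mx_measurable X -> mx_measurable (fun w => a *: X w).
Proof.
move=> mX i j; rewrite (_ : (fun w => _) = (fun w => a * X w i j)).
  by apply: measurable_funM => //; exact: mX.
by apply/funext => w; rewrite mxE.
Qed.

Lemma mx_measurableN (m n : nat) (X : T -> 'M[R]_(m, n)) :
  mx_measurable X -> mx_measurable (fun w => - X w).
Proof.
by move=> mX; have := mx_measurableZ (-1) mX; under eq_fun do rewrite scaleN1r.
Qed.

Lemma mx_measurableM (m n p : nat) (X : T -> 'M[R]_(m, n)) (Y : T -> 'M[R]_(n, p)) :
  mx_measurable X -> mx_measurable Y -> mx_measurable (fun w => X w *m Y w).
Proof.
move=> mX mY i j; rewrite (_ : (fun w => _) = (fun w => \sum_k X w i k * Y w k j)).
  by apply: measurable_sum => k; apply: measurable_funM; [exact: mX|exact: mY].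
by apply/funext => w; rewrite mxE.
Qed.

Lemma mx_measurable_tr (m n : nat) (X : T -> 'M[R]_(m, n)) :
  mx_measurable X -> mx_measurable (fun w => (X w)^T).
Proof. by move=> mX i j; under eq_fun do rewrite mxE; exact: mX. Qed.

Lemma measurable_det (n : nat) (X : T -> 'M[R]_n) :
  mx_measurable X -> measurable_fun setT (fun w => \det (X w)).
Proof.
move=> mX; apply: measurable_sum => s.
by apply: measurable_funM => //; apply: measurable_prod => i _; exact: mX.
Qed.

Lemma mx_measurable_inv (n : nat) (X : T -> 'M[R]_n) :
  mx_measurable X -> (forall w, X w \in unitmx) -> mx_measurable (fun w => invmx (X w)).
Proof.
move=> mX uX i j.
rewrite (_ : (fun w => _) = (fun w => (\det (X w))^-1 * cofactor (X w) j i)).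
  apply: measurable_funM.
    (* As a 1 by 1 random matrix, the determinant fits the continuity criterion; inversion is
       continuous at its values, which are nonzero. *)
    have md : mx_measurable (fun w => (\det (X w))%:M : 'M[R]_1).
      by move=> i' j'; rewrite !ord1; under eq_fun do rewrite mxE; exact: measurable_det.
    rewrite (_ : (fun w => _) = (fun w => (((\det (X w))%:M : 'M[R]_1) 0 0)^-1)).
      apply: (continuous_mx_measurable (phi := fun x : 'M[R]_1 => (x 0 0)^-1) md) => w.
      apply: (@continuous_comp _ _ _ (fun x : 'M[R]_1 => x 0 0) GRing.inv).
        exact: coord_continuous.
      apply: inv_continuous.
      by rewrite mxE mulr1n -unitfE -unitmxE.
    by apply/funext => w; rewrite mxE mulr1n.
  apply: measurable_funM => //; apply: measurable_det => i' j'.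
  by under eq_fun do rewrite !mxE; exact: mX.
by apply/funext => w; rewrite /invmx uX !mxE.
Qed.

(** A partial derivative is the limit of difference quotients along the harmonic sequence, each a
    Caratheodory function at a random point. *)
Lemma mx_measurable_grad (d : nat) (F : T -> 'rV[R]_d -> R) (X : T -> 'rV[R]_d) :
  (forall x, measurable_fun setT (F^~ x)) -> (forall w x, differentiable (F w) x) ->
  mx_measurable X -> mx_measurable (fun w => grad (F w) (X w)).
Proof.
move=> mF dF mX i j; under eq_fun do rewrite mxE.
pose e : 'rV[R]_d := delta_mx 0 j.
apply: (@measurable_fun_cvg _ _ _ _ (fun k w =>
   (harmonic k)^-1 * (F w (harmonic k *: e + X w) - F w (X w)))).
  move=> k; apply: measurable_funM => //; apply: measurable_funB.
    apply: (@caratheodory_measurable _ _ (fun w => harmonic k *: e + X w)) => //.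
      by apply: mx_measurableD => //; exact: mx_measurable_cst.
    by move=> w; exact: differentiable_continuous.
  apply: caratheodory_measurable => // w; exact: differentiable_continuous.
move=> w _.
have dw : derivable (F w) (X w) e by exact: diff_derivable.
have := dw; rewrite /derivable -/(derive (F w) (X w) e) => /cvg_ex[l Hl].
have E : partial j (F w) (X w) = l by apply/cvg_lim.
rewrite E.
apply: (@cvg_comp _ _ _ (@harmonic R) (fun h : R => h^-1 * (F w (h *: e + X w) - F w (X w))) _ (0 : R)^').
  move=> B HB.
  have H : \forall k \near \oo, harmonic k != 0 -> B (harmonic k) := @cvg_harmonic R _ HB.
  change (\forall k \near \oo, B (harmonic k)); apply: filterS H => k; apply.
  by rewrite gt_eqF// harmonic_gt0.
exact: Hl.
Qed.

End Measurability.

Lemma continuous_mxP (R : realType) (m n : nat) (phi : 'M[R]_(m, n) -> R) (N : 'M[R]_(m, n)) :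
  {for N, continuous phi} <->
  forall e : R, 0 < e -> \forall M \near N, `|phi N - phi M| < e.
Proof.
have FN : Filter (nbhs N) by exact: nbhs_filter.
by split => [/(@cvgrPdist_lt _ _ _ (nbhs N) FN)|/(@cvgrPdist_lt _ _ _ (nbhs N) FN)].
Qed.

(** * Continuity of the preconditioner and of the dual norm *)

Section PHContinuity.
Context {R : realType} {d : nat}.
Implicit Types (A M N V W : 'M[R]_d) (x y z : 'rV[R]_d).
Implicit Types (H K : set 'M[R]_d).

Definition entry_sum A : R := \sum_i \sum_j `|A i j|.

Lemma entry_sum_ge0 A : 0 <= entry_sum A.
Proof. by apply: sumr_ge0 => i _; apply: sumr_ge0. Qed.

Lemma entry_sumN A : entry_sum (- A) = entry_sum A.
Proof. by apply: eq_bigr => i _; apply: eq_bigr => j _; rewrite mxE normrN. Qed.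

Lemma qform_le_entry_sum A x : qform A x <= entry_sum A * sqnorm x.
Proof.
rewrite /qform -mulmxA mxE mulr_suml; apply: ler_sum => i _.
rewrite mxE mulr_sumr mulr_suml; apply: ler_sum => j _.
rewrite mxE mulrCA; apply: le_trans (ler_norm _) _; rewrite normrM ler_wpM2l//.
have le_sq (k : 'I_d) : x 0 k ^+ 2 <= sqnorm x.
  by rewrite /sqnorm (bigD1 k)//= lerDl sumr_ge0// => l _; exact: sqr_ge0.
have := le_sq i; have := le_sq j.
have := sqr_ge0 (`|x 0 i| - `|x 0 j|).
rewrite sqrrB !real_normK ?num_real// normrM; lra.
Qed.

(** Polarization gives [4 A i j] as a difference of two forms, and the parallelogram identity bounds
    their sizes by [4 c] in total. *)
Lemma entry_le_qform A c i j : A^T = A -> (forall x, `|qform A x| <= c * sqnorm x) ->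
  `|A i j| <= c.
Proof.
move=> sA Ac; rewrite -bform_delta.
set u := delta_mx 0 i; set v := delta_mx 0 j.
have u1 (k : 'I_d) : sqnorm (delta_mx 0 k : 'rV[R]_d) = 1.
  rewrite /sqnorm (bigD1 k)//= big1 => [|l lk]; first by rewrite mxE !eqxx expr1n addr0.
  by rewrite mxE eqxx (negbTE lk) expr0n.
have P : qform A (u + 1 *: v) - qform A (u + (-1) *: v) = 4 * bform A u v.
  by rewrite !qform_line//; ring.
have S : sqnorm (u + 1 *: v) + sqnorm (u + (-1) *: v) = 4.
  have E y : sqnorm y = qform 1%:M y by rewrite qform_scalar mul1r.
  rewrite !E !qform_line ?tr_scalar_mx// -!E !u1; ring.
have H1 := Ac (u + 1 *: v); have H2 := Ac (u + (-1) *: v).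
have : `|4 * bform A u v| <= c * 4.
  rewrite -P -S mulrDr; apply: le_trans (ler_normB _ _) _; exact: lerD.
by rewrite normrM ger0_norm// mulrC ler_pM2r.
Qed.

Lemma PH_dist K M1 V1 M2 V2 i j : matrix_algebra K ->
  algebra_sqrt K M1 V1 -> algebra_sqrt K M2 V2 ->
  `|V1 i j - V2 i j| <= Num.sqrt (entry_sum (M1 - M2)).
Proof.
move=> aK s1 s2; set c := entry_sum (M1 - M2).
have le12 x : qform M1 x <= qform M2 x + c * sqnorm x.
  by rewrite -lerBlDl -qformN -qformD qform_le_entry_sum.
have le21 x : qform M2 x <= qform M1 x + c * sqnorm x.
  by rewrite -lerBlDl -qformN -qformD /c -entry_sumN opprB qform_le_entry_sum.
have h1 := algebra_sqrt_le aK (entry_sum_ge0 _) s1 s2 le12.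
have h2 := algebra_sqrt_le aK (entry_sum_ge0 _) s2 s1 le21.
have [_ [sV1 _] _] := s1; have [_ [sV2 _] _] := s2.
have -> : V1 i j - V2 i j = (V1 - V2) i j by rewrite !mxE.
apply: entry_le_qform; first by rewrite linearB /= sV1 sV2.
move=> x; rewrite qformD qformN ler_norml; have := h1 x; have := h2 x.
by move=> *; apply/andP; split; lra.
Qed.

Lemma continuous_entry_sum N : {for N, continuous (fun M => entry_sum (M - N))}.
Proof.
suff : continuous (fun M => entry_sum (M - N)) by exact.
apply: continuous_sumr => i; apply: continuous_sumr => j M.
rewrite (_ : (fun x : 'M[R]_d => _) = (fun x : 'M[R]_d => `|x i j - N i j|)); last first.
  by apply/funext => x; rewrite !mxE.
apply: (@continuous_comp _ _ _ (fun x : 'M[R]_d => x i j - N i j) (@Num.norm _ R)).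
  apply: (@continuousB _ _ _ (fun x : 'M[R]_d => x i j) (fun=> N i j)).
    exact: coord_continuous.
  exact: cst_continuous.
exact: norm_continuous.
Qed.

Lemma continuous_PH H K (eps : R) N i j : matrix_algebra K -> H = @psd R d `&` K ->
  0 < eps -> (forall x, 0 <= qform N x) ->
  {for N, continuous (fun M => PH H (M + eps%:M) i j)}.
Proof.
move=> aK HK eps0 N0.
(* A matrix near [N] may fail to be positive semidefinite; within distance [eps] the shift by
   [eps I] makes up for it. *)
have pos M : entry_sum (M - N) < eps ->
    algebra_sqrt K (M + eps%:M) (PH H (M + eps%:M)).
  move=> MN; apply: PH_algebra_sqrt => // x x0.
  have -> : M + eps%:M = N - (N - M) + eps%:M by rewrite opprB addrCA subrr addr0.
  rewrite qformD qform_scalar [qform (N - _) _]qformD qformN.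
  have E : entry_sum (N - M) = entry_sum (M - N) by rewrite -entry_sumN opprB.
  have := qform_le_entry_sum (N - M) x; rewrite E.
  have : entry_sum (M - N) * sqnorm x < eps * sqnorm x by rewrite ltr_pM2r// sqnorm_gt0.
  have := N0 x; lra.
apply/continuous_mxP => e e0.
have e2 : 0 < e ^+ 2 by rewrite exprn_gt0.
have /continuous_mxP C : {for N, continuous (fun M => entry_sum (M - N))}.
  exact: continuous_entry_sum.
have := C (Num.min eps (e ^+ 2)).
have EN : entry_sum (N - N) = 0.
  by rewrite subrr /entry_sum big1// => k _; rewrite big1// => l _; rewrite mxE normr0.
rewrite EN lt_min eps0 e2 => /(_ isT); apply: filterS => M.
rewrite sub0r normrN ger0_norm ?entry_sum_ge0// lt_min => /andP[M1 M2].
have {}sN : algebra_sqrt K (N + eps%:M) (PH H (N + eps%:M)) by apply: pos; rewrite EN.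
rewrite distrC; apply: (le_lt_trans (PH_dist i j aK (pos _ M1) sN)).
rewrite (_ : M + eps%:M - (N + eps%:M) = M - N); last by rewrite opprD addrACA subrr addr0.
by rewrite -[ltRHS]gtr0_norm// -sqrtr_sqr ltr_sqrt.
Qed.

Lemma continuous_Hdualnorm H K : H = @psd R d `&` K -> matrix_algebra K ->
  continuous (Hdualnorm H).
Proof.
move=> HK aK y.
have csq : {for y, continuous (fun z => d%:R * sqnorm (z - y))}.
  suff : continuous (fun z : 'rV[R]_d => d%:R * sqnorm (z - y)) by exact.
  move=> z; apply: (@continuousM _ _ (fun=> d%:R) (fun z : 'rV[R]_d => sqnorm (z - y))).
    exact: cst_continuous.
  apply: continuous_sumr => i x.
  rewrite (_ : (fun x : 'rV[R]_d => _) = (fun x => (x 0 i - y 0 i) * (x 0 i - y 0 i))); last first.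
    by apply/funext => u; rewrite !mxE expr2.
  have c1 : {for x, continuous (fun u : 'rV[R]_d => u 0 i - y 0 i)}.
    apply: (@continuousB _ _ _ (fun x : 'rV[R]_d => x 0 i) (fun=> y 0 i)).
      exact: coord_continuous.
    exact: cst_continuous.
  exact: (continuousM c1 c1).
apply/continuous_mxP => e e0.
have e2 : 0 < e ^+ 2 by rewrite exprn_gt0.
have /continuous_mxP/(_ _ e2) := csq.
have y0 : sqnorm (y - y) = 0 by rewrite subrr; apply/eqP; rewrite sqnorm_eq0.
rewrite y0 mulr0; apply: filterS => z; rewrite sub0r normrN.
have dz : 0 <= d%:R * sqnorm (z - y) by rewrite mulr_ge0 ?sqnorm_ge0.
rewrite ger0_norm// => zy.
have sC : sqnorm (y - z) = sqnorm (z - y).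
  by apply: eq_bigr => i _; rewrite !mxE -sqrrN opprB.
have h1 := Hdualnorm_leD y z HK aK; have h2 := Hdualnorm_leD z y HK aK.
rewrite sC in h1.
have : Num.sqrt (d%:R * sqnorm (z - y)) < e.
  by rewrite -[ltRHS]gtr0_norm// -sqrtr_sqr ltr_sqrt.
by move=> ?; rewrite ltr_norml; apply/andP; split; lra.
Qed.

End PHContinuity.

Section AlgorithmMeasurability.
Context {R : realType} {d : nat} {dd : measure_display} {T : measurableType dd}.
Variables (H K : set 'M[R]_d) (eps beta eta : R) (x0 : 'rV[R]_d).
Variables (f : 'rV[R]_d -> R) (Sigma : 'M[R]_d).
Hypotheses (aK : matrix_algebra K) (HK : H = @psd R d `&` K).
Hypotheses (eps_gt0 : 0 < eps) (beta01 : 0 < beta <= 1).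
Hypotheses (psdS : psd Sigma) (C2f : C2 f).
Variable G : T -> nat -> 'rV[R]_d -> 'rV[R]_d.
Local Notation x t := (fun w => ada_x H eps beta eta x0 (G w) t).

Let beta_ge0 : 0 <= beta. Proof. by case/andP: beta01 => /ltW. Qed.

Definition measurable_oracle (s : nat) : Prop :=
  forall X : T -> 'rV[R]_d, mx_measurable X -> mx_measurable (fun w => G w s (X w)).

Lemma mx_measurable_PH (M : T -> 'M[R]_d) : mx_measurable M ->
  (forall w z, 0 <= qform (M w) z) -> mx_measurable (fun w => PH H (M w + eps%:M)).
Proof.
move=> mM M0 i j.
apply: (continuous_mx_measurable (phi := fun N => PH H (N + eps%:M) i j) mM) => w.
exact: (@continuous_PH _ _ H K eps (M w) i j aK HK eps_gt0 (M0 w)).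
Qed.

Lemma mx_measurable_PH_inv (M : T -> 'M[R]_d) : mx_measurable M ->
  (forall w z, 0 <= qform (M w) z) ->
  mx_measurable (fun w => invmx (PH H (M w + eps%:M))).
Proof.
move=> mM M0; apply: mx_measurable_inv; first exact: mx_measurable_PH.
move=> w; have [_ pV _] : algebra_sqrt K (M w + eps%:M) (PH H (M w + eps%:M)).
  by apply: (PH_sqrt aK HK eps_gt0); exact: M0.
exact: pd_unit.
Qed.

(** [T] is an arbitrary measurable type: applied to the sigma-algebra of the past, the lemma says
    that [x_t] is determined by the earlier functions. *)
Lemma ada_measurable t : (forall s, (s < t)%N -> measurable_oracle s) ->
  mx_measurable (x t) /\ mx_measurable (fun w => ada_Mprev H eps beta eta x0 (G w) t).
Proof.
elim: t => [|t IH] mG.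
  by split=> i j; exact: measurable_cst.
have [mx mM] := IH (fun s st => mG s (leqW st)).
have mg := mG t (ltnSn t) _ mx.
have mMt : mx_measurable (fun w => ada_M H eps beta eta x0 (G w) t).
  apply: mx_measurableD; first exact: mx_measurableZ.
  by apply: mx_measurableM => //; exact: mx_measurable_tr.
split; last first.
  by under eq_fun do rewrite ada_MprevS.
under eq_fun do rewrite ada_xS.
apply: mx_measurableD => //; apply: mx_measurableN; apply: mx_measurableZ.
apply: mx_measurableM => //; apply: mx_measurable_PH_inv => // w z.
rewrite qformD qformZ addr_ge0 ?mulr_ge0// ?qform_outer ?sqr_ge0//.
exact: ada_Mprev_ge0.
Qed.

Lemma mx_measurable_gradf (X : T -> 'rV[R]_d) : mx_measurable X ->
  mx_measurable (fun w => grad f (X w)).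
Proof. by case: C2f => df _ _ mX; exact: (mx_measurable_grad (F := fun=> f)). Qed.

Lemma lookahead_inv_measurable t : (forall s, (s < t)%N -> measurable_oracle s) ->
  mx_measurable (fun w => invmx (lookahead_V H eps beta eta x0 f Sigma (G w) t)).
Proof.
move=> /ada_measurable[mx mM]; have mh := mx_measurable_gradf mx.
apply: mx_measurable_PH_inv => [|w z].
  apply: mx_measurableD; first exact: mx_measurableZ.
  apply: mx_measurableD; last exact: mx_measurable_cst.
  by apply: mx_measurableM => //; exact: mx_measurable_tr.
rewrite !qformD qformZ !addr_ge0 ?mulr_ge0 ?qform_outer ?sqr_ge0 ?psdS.2//.
exact: ada_Mprev_ge0.
Qed.

End AlgorithmMeasurability.

(** * Independence *)

Section Freezing.
Context {R : realType} {dd : measure_display} {Omega : measurableType dd}.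
Variables (P : probability Omega R) (GA GB : set (set Omega)).
Hypotheses (mA : GA `<=` measurable) (mB : GB `<=` measurable).
Hypothesis indep : forall A B, <<s GA >> A -> <<s GB >> B -> P (A `&` B) = (P A * P B)%E.

Local Notation T1 := (g_sigma_algebraType GA).
Local Notation T2 := (g_sigma_algebraType GB).

(** The identity of [Omega], regarded as a map to the coarser measurable space generated by [GA]. *)
Definition to_left (w : Omega) : T1 := w.
Definition to_right (w : Omega) : T2 := w.
Definition diag_pair (w : Omega) : T1 * T2 := (to_left w, to_right w).

Lemma g_sigma_sub (G : set (set Omega)) : G `<=` measurable -> <<s G >> `<=` measurable.
Proof. by move=> mG; apply: smallest_sub => //; exact: sigma_algebra_measurable. Qed.

Lemma measurable_to_left : measurable_fun setT to_left.
Proof. by move=> _ B mB'; rewrite setTI; exact: (g_sigma_sub mA). Qed.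

Lemma measurable_to_right : measurable_fun setT to_right.
Proof. by move=> _ B mB'; rewrite setTI; exact: (g_sigma_sub mB). Qed.

Lemma measurable_diag_pair : measurable_fun setT diag_pair.
Proof. exact: measurable_fun_pair measurable_to_left measurable_to_right. Qed.

HB.instance Definition _ := isMeasurableFun.Build _ _ _ _ to_left measurable_to_left.
HB.instance Definition _ := isMeasurableFun.Build _ _ _ _ to_right measurable_to_right.
HB.instance Definition _ := isMeasurableFun.Build _ _ _ _ diag_pair measurable_diag_pair.

Local Notation P1 := (distribution P to_left).
Local Notation P2 := (distribution P to_right).

(** The diagonal pulls a rectangle back to an intersection, so independence is agreement on
    rectangles, and these determine the product measure. *)
Lemma joint_distribution A : measurable A ->
  (P1 \x P2)%E A = distribution P diag_pair A.
Proof.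
apply: product_measure_unique => B C mB' mC' /=.
exact: indep.
Qed.

(* When [<<s GA>>] and [<<s GB>>] are independent, the diagonal [w |-> (w, w)] pushes [P]
   to a product measure, so the past can be frozen before integrating over the
   present. *)
Lemma freezing_null A : measurable A ->
  (forall w1, P [set w2 | A (to_left w1, to_right w2)] = 0%E) ->
  P [set w | A (diag_pair w)] = 0%E.
Proof.
move=> mA' A0.
have -> : P [set w | A (diag_pair w)] = distribution P diag_pair A by [].
rewrite -joint_distribution//.
transitivity (\int[P1]_w P2 (xsection A w))%E; first by [].
apply: integral0_eq => w1 _.
rewrite -[RHS](A0 w1); congr (P _).
by apply/seteqP; split=> w2; rewrite /xsection /= inE.
Qed.

(** Fubini for the product law: with the past [w1] fixed, [c] is a constant and the inner integral
    of [k] is [m], the conditional expectation of [k] given the past. *)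
Lemma freezing_integral (c m : T1 -> R) (k : T1 * T2 -> R) :
  measurable_fun setT c -> measurable_fun setT m -> measurable_fun setT k ->
  P.-integrable setT (fun w => (c (to_left w) * k (diag_pair w))%:E) ->
  P.-integrable setT (fun w => (c (to_left w) * m (to_left w))%:E) ->
  (forall w1, P.-integrable setT (fun w => (k (to_left w1, to_right w))%:E) /\
     (\int[P]_w (k (to_left w1, to_right w))%:E = (m (to_left w1))%:E)%E) ->
  (\int[P]_w (c (to_left w) * k (diag_pair w))%:E =
   \int[P]_w (c (to_left w) * m (to_left w))%:E)%E.
Proof.
move=> mc mm mk ick icm km.
pose h (p : T1 * T2) : \bar R := (c p.1 * k p)%:E.
have mh : measurable_fun setT h.
  apply/measurable_EFinP; apply: measurable_funM => //.
  by apply: measurableT_comp.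
have -> : (\int[P]_w (c (to_left w) * k (diag_pair w))%:E = \int[distribution P diag_pair]_p h p)%E.
  by rewrite integral_distribution.
have ih : (P1 \x P2)%E.-integrable setT h.
  have : (distribution P diag_pair).-integrable setT h by apply: integrable_pushforward.
  move=> /integrableP[_ fin]; apply/integrableP; split => //.
  rewrite (eq_measure_integral (distribution P diag_pair))// => A mA' _.
  exact: joint_distribution.
have -> : (\int[distribution P diag_pair]_p h p = \int[(P1 \x P2)%E]_p h p)%E.
  apply: eq_measure_integral => A mA' _.
  exact: esym (joint_distribution mA').
rewrite -integral12_prod_meas1// /fubini_F.
have -> : (\int[P]_w (c (to_left w) * m (to_left w))%:E = \int[P1]_w (c w * m w)%:E)%E.
  rewrite integral_distribution//; apply/measurable_EFinP; exact: measurable_funM.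
apply: eq_integral => w1 _; rewrite /h /=.
have [ik Ik] := km w1.
have mk1 : measurable_fun setT (fun y : T2 => (k (w1, y))%:E).
  by apply/measurable_EFinP; apply: measurableT_comp => //; exact: measurable_pair1.
under eq_integral do rewrite EFinM.
rewrite integralZl//; last by apply: integrable_pushforward.
by rewrite integral_distribution// EFinM; congr (_ * _)%E.
Qed.

End Freezing.

Section Independence.
Context {R : realType} {dd : measure_display} {Omega : measurableType dd}.
Variables (P : probability Omega R) (X : Type) (F : nat -> Omega -> X -> R) (T : nat).
Hypothesis mF : forall t, (t < T)%N -> forall x, measurable_fun setT (fun w => F t w x).
Hypothesis indF : mutually_independent P (fun t => rfun_sigma (F t)) T.

Definition rfun_events (t : nat) : set (set Omega) :=
  [set E | exists x B, measurable B /\ E = (fun w => F t w x) @^-1` B].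

Definition past_events (t : nat) : set (set Omega) :=
  [set E | exists s x B, [/\ (s < t)%N, measurable B & E = (fun w => F s w x) @^-1` B]].

Lemma rfun_events_measurable t : (t < T)%N -> rfun_events t `<=` measurable.
Proof.
by move=> tT _ [x [B [mB ->]]]; rewrite -[X in measurable X]setTI; exact: mF.
Qed.

Lemma past_events_measurable t : (t <= T)%N -> past_events t `<=` measurable.
Proof.
move=> tT _ [s [x [B [st mB ->]]]]; rewrite -[X in measurable X]setTI.
by apply: mF => //; exact: leq_trans st tT.
Qed.

(** Unlike [past_events], a family closed under intersection, on which mutual independence applies
    directly. *)
Definition past_cylinders (t : nat) : set (set Omega) :=
  [set E | exists A : nat -> set Omega, (forall s, (s < t)%N -> rfun_sigma (F s) (A s)) /\
     E = \big[setI/setT]_(s <- iota 0 t) A s].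

Lemma past_cylinders_setI t : setI_closed (past_cylinders t).
Proof.
move=> _ _ [A [mA ->]] [B [mB ->]]; exists (fun s => A s `&` B s); split.
  move=> s st; exact: (@measurableI _ (g_sigma_algebraType (rfun_events s))) (mA s st) (mB s st).
by rewrite big_split.
Qed.

Lemma past_cylinders_measurable t : (t <= T)%N -> past_cylinders t `<=` measurable.
Proof.
move=> tT _ [A [mA ->]]; rewrite big_seq; apply: big_ind => //.
  by move=> ? ?; exact: measurableI.
move=> s; rewrite mem_iota add0n /= => st.
apply: (g_sigma_sub (rfun_events_measurable (leq_trans st tT))); exact: mA.
Qed.

Lemma past_events_sub t : <<s past_events t >> `<=` <<s past_cylinders t >>.
Proof.
apply: smallest_sub; first exact: smallest_sigma_algebra.
move=> _ [s [x [B [st mB ->]]]]; apply: sub_sigma_algebra.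
exists (fun r => if r == s then (fun w => F s w x) @^-1` B else setT); split.
  move=> r rt; case: eqP => [->|_].
    by apply: sub_sigma_algebra; exists x, B.
  exact: (@measurableT _ (g_sigma_algebraType (rfun_events r))).
rewrite (bigD1_seq s) ?iota_uniq ?mem_iota//= eqxx big1 ?setIT// => r /negbTE ->.
by [].
Qed.

(** For fixed [B], the finite measures [P (C & B)] and [P C * P B] of [C] agree on the cylinders,
    hence on the sigma-algebra these generate. *)
Lemma past_independent t A B : (t < T)%N ->
  <<s past_events t >> A -> <<s rfun_events t >> B -> P (A `&` B) = (P A * P B)%E.
Proof.
move=> tT /past_events_sub sA sB.
have mB : measurable B by exact: (g_sigma_sub (rfun_events_measurable tT)).
have PB0 : 0 <= fine (P B) by rewrite fine_ge0.
have PBE : (fine (P B))%:E = P B by rewrite fineK// fin_num_measure.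
have mscE C : mscale (NngNum PB0) P C = (P C * P B)%E.
  transitivity ((fine (P B))%:E * P C)%E; first by [].
  by rewrite PBE muleC.
rewrite -mscE; have := @g_sigma_algebra_measure_unique _ R Omega (past_cylinders t)
  (past_cylinders_measurable (ltnW tT)) (fun=> setT) _ _
  (mrestr P mB) (mscale (NngNum PB0) P) (@past_cylinders_setI t) _ _ A sA.
apply.
- move=> _; exists (fun=> setT); split; last by rewrite big1.
  by move=> s _; exact: (@measurableT _ (g_sigma_algebraType (rfun_events s))).
- by apply/seteqP; split => // w _; exists 0%N.
- move=> _ [C [mC ->]].
  pose D s := if s == t then B else C s.
  have mD s : (s <= t)%N -> rfun_sigma (F s) (D s).
    rewrite /D leq_eqVlt => /predU1P[->|st]; first by rewrite eqxx.
    by rewrite ltn_eqF//; exact: mC.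
  (* Mutual independence asks for an event at every index below [T]; the later ones are filled with
     the whole space. *)
  pose D' s := if (s <= t)%N then D s else setT.
  have mD' s : (s < T)%N -> rfun_sigma (F s) (D' s).
    move=> _; rewrite /D'; case: ifP => [|_]; first exact: mD.
    exact: (@measurableT _ (g_sigma_algebraType (rfun_events s))).
  have DC : forall s, s \in iota 0 t -> D' s = C s.
    by move=> s; rewrite mem_iota add0n /= => st; rewrite /D' /D (ltnW st) ltn_eqF.
  have allT n : (n <= T)%N -> all (fun t => (t < T)%N) (iota 0 n).
    move=> nT; apply/allP => s; rewrite mem_iota add0n /= => sn; exact: leq_trans sn nT.
  have E1 := indF mD' (iota_uniq 0 t) (allT t (ltnW tT)).
  have E2 := indF mD' (iota_uniq 0 t.+1) (allT t.+1 tT).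
  have S : iota 0 t.+1 = rcons (iota 0 t) t by rewrite -addn1 iotaD cats1.
  have D't : D' t = B by rewrite /D' leqnn /D eqxx.
  rewrite S !big_rcons /= D't -E1 in E2.
  have E3 : \big[setI/setT]_(s <- iota 0 t) D' s = \big[setI/setT]_(s <- iota 0 t) C s.
    by apply: eq_big_seq.
  rewrite E3 in E2.
  exact: etrans E2 (esym (mscE _)).
- by move=> _; rewrite /mrestr ltey_eq fin_num_measure//; exact: measurableI.
Qed.

End Independence.

(** * Expected stationarity *)

(* Countably many test vectors, so that almost sure semidefiniteness at each of them
   holds simultaneously. *)
Lemma qform_ge0_int {R : realType} {d : nat} (B : 'M[R]_d) :
  (forall z : 'rV[int]_d, 0 <= qform B (map_mx intr z)) -> forall z, 0 <= qform B z.
Proof.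
move=> Bz z.
apply: (@closed_cvg _ _ \oo _ (fun k => qform B (ungrid k (grid k z))) (fun y => 0 <= y)).
- exact: closed_ge.
- apply: nearW => k /=; rewrite /ungrid qformE bformZl bformZr -qformE.
  by rewrite !mulr_ge0 ?invr_ge0.
- apply: (@cvg_comp _ _ _ (fun k => ungrid k (grid k z)) (qform B)).
    exact: grid_cvg.
  exact: continuous_qform.
Qed.

Lemma continuous_rV_bounded {R : realType} {d : nat} (phi : 'rV[R]_d -> R) (C : R) :
  continuous phi -> exists B, forall y : 'rV[R]_d, (forall i, `|y 0 i| <= C) -> `|phi y| <= B.
Proof.
move=> cphi.
pose S := [set y : 'rV[R]_d | forall i, `[(- C), C]%classic (y 0 i)].
have cS : compact S by apply: (@rV_compact _ _ (fun=> `[(- C), C]%classic)) => i; exact: segment_compact.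
have SP (y : 'rV[R]_d) : (forall i, `|y 0 i| <= C) -> S y.
  by move=> yC i; rewrite /= in_itv /= -ler_norml.
have [[y0 Sy0]|S0] := pselect (S !=set0); last first.
  by exists 0 => y /SP Sy; exfalso; apply: S0; exists y.
have cn : continuous (fun y => `|phi y|).
  by move=> y; apply: (@continuous_comp _ _ _ phi (@Num.norm _ R)); [exact: cphi|exact: norm_continuous].
have [c cS' cmax] := EVT_max_rV (ex_intro _ y0 Sy0) cS (continuous_subspaceT cn).
by exists `|phi c| => y /SP Sy; apply: cmax; exact: mem_set.
Qed.

Section Expectation.
Context {R : realType} {dd : measure_display} {Omega : measurableType dd}.
Variable P : probability Omega R.
Implicit Types (phi psi : Omega -> R).

Definition integrableR phi := P.-integrable setT (fun w => (phi w)%:E).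
Local Notation EE phi := (Rintegral P setT phi).

Lemma ae_impl (Q1 Q2 : Omega -> Prop) : (forall w, Q1 w -> Q2 w) ->
  {ae P, forall w, Q1 w} -> {ae P, forall w, Q2 w}.
Proof. by move=> q12; apply: filterS. Qed.

Lemma ae_and (Q1 Q2 : Omega -> Prop) : {ae P, forall w, Q1 w} -> {ae P, forall w, Q2 w} ->
  {ae P, forall w, Q1 w /\ Q2 w}.
Proof.
move=> q1 q2.
have : {ae P, forall w, forall n : nat, if n is 0 then Q1 w else Q2 w}.
  by apply: ae_foralln => -[|n].
by apply: filterS => w qw; split; [exact: (qw 0%N)|exact: (qw 1%N)].
Qed.

Lemma integrableR_cst c : integrableR (fun=> c).
Proof. exact: finite_measure_integrable_cst. Qed.

Lemma Rintegral_cst_prob c : EE (fun=> c) = c.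
Proof.
transitivity (c * fine (P setT)); first exact: Rintegral_cst.
by rewrite (_ : P setT = 1%E) ?mulr1//; exact: probability_setT.
Qed.

Lemma integrableRD phi psi : integrableR phi -> integrableR psi ->
  integrableR (fun w => phi w + psi w).
Proof. exact: integrableD. Qed.

Lemma integrableRZ c phi : integrableR phi -> integrableR (fun w => c * phi w).
Proof. exact: integrableZl. Qed.

Lemma integrableRB phi psi : integrableR phi -> integrableR psi ->
  integrableR (fun w => phi w - psi w).
Proof. exact: integrableB. Qed.

Lemma EE_D phi psi : integrableR phi -> integrableR psi ->
  EE (fun w => phi w + psi w) = EE phi + EE psi.
Proof. by move=> *; rewrite RintegralD. Qed.

Lemma EE_Z c phi : integrableR phi -> EE (fun w => c * phi w) = c * EE phi.
Proof. by move=> *; rewrite RintegralZl. Qed.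

Lemma EE_B phi psi : integrableR phi -> integrableR psi ->
  EE (fun w => phi w - psi w) = EE phi - EE psi.
Proof. by move=> *; rewrite RintegralB. Qed.

Lemma integrableR_sum (I : Type) (s : seq I) (phi : I -> Omega -> R) :
  (forall i, integrableR (phi i)) -> integrableR (fun w => \sum_(i <- s) phi i w).
Proof.
move=> iphi; elim: s => [|i s IH].
  by under eq_fun do rewrite big_nil; exact: integrableR_cst.
by under eq_fun do rewrite big_cons; exact: integrableRD.
Qed.

Lemma EE_sum (I : Type) (s : seq I) (phi : I -> Omega -> R) :
  (forall i, integrableR (phi i)) ->
  EE (fun w => \sum_(i <- s) phi i w) = \sum_(i <- s) EE (phi i).
Proof.
move=> iphi; elim: s => [|i s IH].
  by under eq_Rintegral do rewrite big_nil; rewrite big_nil Rintegral_cst_prob.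
under eq_Rintegral do rewrite big_cons.
by rewrite big_cons EE_D ?IH//; exact: integrableR_sum.
Qed.

Lemma integrableR_measurable phi : integrableR phi -> measurable_fun setT phi.
Proof. by move=> /measurable_int/measurable_EFinP. Qed.

Lemma ae_dominated_integrableR phi psi : measurable_fun setT phi -> integrableR psi ->
  {ae P, forall w, `|phi w| <= psi w} -> integrableR phi.
Proof.
move=> mphi ipsi bphi; apply/integrableP; split; first exact/measurable_EFinP.
have /integrableP[mpsi fin] := ipsi; apply: le_lt_trans fin.
apply: ae_ge0_le_integral => //.
- by apply: measurableT_comp => //; exact/measurable_EFinP.
- exact: measurableT_comp.
- by move: bphi; apply: filterS => w wC _; rewrite lee_fin (le_trans wC)// ler_norm.
Qed.

Lemma ae_bounded_integrableR phi C : measurable_fun setT phi ->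
  {ae P, forall w, `|phi w| <= C} -> integrableR phi.
Proof. by move=> mphi; apply: ae_dominated_integrableR => //; exact: integrableR_cst. Qed.

(** The minimum of [phi] and [psi] equals [phi] almost everywhere and is below [psi] everywhere,
    which reduces to the pointwise comparison. *)
Lemma ae_le_EE phi psi : integrableR phi -> integrableR psi ->
  {ae P, forall w, phi w <= psi w} -> EE phi <= EE psi.
Proof.
move=> iphi ipsi le_ae.
have [mphi mpsi] := (integrableR_measurable iphi, integrableR_measurable ipsi).
pose chi w := Num.min (phi w) (psi w).
have mchi : measurable_fun setT chi by exact: measurable_minr.
have ae_eq : {ae P, forall w, setT w -> (phi w)%:E = (chi w)%:E}.
  by move: le_ae; apply: filterS => w /min_idPl E _; rewrite /chi E.
have E : EE phi = EE chi.
  by rewrite /Rintegral; congr fine; apply: ae_eq_integral => //; exact/measurable_EFinP.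
have ichi : integrableR chi.
  apply/integrableP; split; first exact/measurable_EFinP.
  have /integrableP[_ fin] := iphi; apply: le_lt_trans fin.
  rewrite le_eqVlt; apply/orP; left; apply/eqP; apply: ae_eq_integral => //.
  - by apply: measurableT_comp => //; exact/measurable_EFinP.
  - by apply: measurableT_comp => //; exact/measurable_EFinP.
  - by move: ae_eq; apply: filterS => w E' _; rewrite E'.
rewrite E; apply: le_Rintegral => //.
by move=> w _; rewrite /chi ge_min lexx orbT.
Qed.

Lemma integral_EE phi : integrableR phi -> (\int[P]_w (phi w)%:E = (EE phi)%:E)%E.
Proof. by move=> iphi; rewrite /Rintegral fineK//; exact: integrable_fin_num. Qed.

End Expectation.

(** * Conditioning on the past and the bound on the expected stationarity *)

Section StochasticAnalysis.
Context {R : realType} {d : nat} {dd : measure_display} {Omega : measurableType dd}.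
Variables (P : probability Omega R) (H K : set 'M[R]_d) (eps beta eta : R) (T : nat).
Variables (f : 'rV[R]_d -> R) (x0 : 'rV[R]_d) (F : nat -> Omega -> 'rV[R]_d -> R).
Variable Sigma : 'M[R]_d.
Hypotheses (aK : matrix_algebra K) (HK : H = @psd R d `&` K).
Hypotheses (eps_gt0 : 0 < eps) (beta01 : 0 < beta <= 1) (eta_gt0 : 0 < eta).
Hypothesis C2f : C2 f.
Hypothesis dF : forall t, (t < T)%N -> forall w x, differentiable (F t w) x.
Hypothesis mF : forall t, (t < T)%N -> forall x, measurable_fun setT (fun w => F t w x).
Hypothesis indF : mutually_independent P (fun t => rfun_sigma (F t)) T.
Hypothesis psdS : psd Sigma.
Hypothesis meanF : forall t, (t < T)%N -> forall x (i : 'I_d),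
  P.-integrable setT (fun w => (grad (F t w) x 0 i)%:E) /\
  (\int[P]_w (grad (F t w) x 0 i)%:E = (grad f x 0 i)%:E)%E.
Hypothesis noiseF : forall t, (t < T)%N -> forall x, {ae P, forall w,
  loewner (- Sigma) ((grad f x)^T *m grad f x - (grad (F t w) x)^T *m grad (F t w) x) /\
  loewner ((grad f x)^T *m grad f x - (grad (F t w) x)^T *m grad (F t w) x) Sigma}.

#[local] Opaque PH ada_state.

Local Notation EE phi := (Rintegral P setT phi).
Definition grad_oracle (w : Omega) (s : nat) (x : 'rV[R]_d) : 'rV[R]_d := grad (F s w) x.
Local Notation G := grad_oracle.
Definition iterate (t : nat) (w : Omega) := ada_x H eps beta eta x0 (G w) t.
Local Notation x := iterate.
Local Notation g t w := (grad (F t w) (x t w)).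
Local Notation h t w := (grad f (x t w)).
Definition lookahead_inv (t : nat) (w : Omega) :=
  invmx (lookahead_V H eps beta eta x0 f Sigma (G w) t).
Local Notation U := lookahead_inv.
Definition stationarity_at (t : nat) (w : Omega) := stationarity H eps beta eta x0 f Sigma (G w) t.
Local Notation r := stationarity_at.

Lemma oracle_measurable s : (s < T)%N -> measurable_oracle G s.
Proof. by move=> sT X mX; apply: mx_measurable_grad => //; [exact: mF|exact: dF]. Qed.

Lemma iterate_measurable t : (t <= T)%N -> mx_measurable (x t).
Proof.
move=> tT; have oG s (st : (s < t)%N) := oracle_measurable (leq_trans st tT).
by have [] := @ada_measurable _ _ _ Omega H K eps beta eta x0 aK HK eps_gt0 beta01 G t oG.
Qed.

Lemma grad_iterate_measurable t : (t <= T)%N -> mx_measurable (fun w => h t w).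
Proof. by move=> tT; apply: mx_measurable_gradf => //; exact: iterate_measurable. Qed.

Lemma lookahead_measurable t : (t <= T)%N -> mx_measurable (U t).
Proof.
move=> tT; have oG s (st : (s < t)%N) := oracle_measurable (leq_trans st tT).
exact: (@lookahead_inv_measurable _ _ _ Omega H K eps beta eta x0 f Sigma aK HK eps_gt0 beta01
  psdS C2f G t oG).
Qed.

Lemma iterate_bounded t : exists C, forall w i, `|x t w 0 i| <= C.
Proof.
elim: t => [|s [C IH]].
  by exists (\sum_i `|x0 0 i|) => w i; rewrite (bigD1 i)//= lerDl sumr_ge0.
exists (C + eta * Num.sqrt d%:R) => w i.
have E (a b : 'rV[R]_d) : (a - eta *: b) 0 i = a 0 i - eta * b 0 i by rewrite !mxE.
rewrite /iterate ada_xS E; apply: (le_trans (ler_normB _ _)); apply: lerD; first exact: IH.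
rewrite normrM gtr0_norm// ler_wpM2l ?(ltW eta_gt0)//.
set v := _ *m _; rewrite -sqrtr_sqr ler_wsqrtr//.
apply: le_trans (@ada_step_bounded _ _ H K eps beta eta x0 aK HK eps_gt0 beta01 (G w) s).
 rewrite -/v /sqnorm (bigD1 i)//= lerDl sumr_ge0// => j _; exact: sqr_ge0.
Qed.

Section Past.
Variable t : nat.
Hypothesis tT : (t < T)%N.
Local Notation T1 := (g_sigma_algebraType (past_events F t)).
Local Notation T2 := (g_sigma_algebraType (rfun_events F t)).

Lemma past_oracle_measurable s : (s < t)%N -> @measurable_oracle _ _ _ T1 G s.
Proof.
move=> st X mX; apply: (@mx_measurable_grad _ _ T1 d (fun w => F s w)) => //.
  move=> y _ B mB; rewrite setTI; apply: sub_sigma_algebra.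
  by exists s, y, B.
by move=> w y; apply: dF; exact: ltn_trans st tT.
Qed.

Lemma past_iterate_measurable : @mx_measurable _ _ T1 _ _ (x t).
Proof.
by have [] := @ada_measurable _ _ _ T1 H K eps beta eta x0 aK HK eps_gt0 beta01 G t
  past_oracle_measurable.
Qed.

Lemma past_grad_measurable : @mx_measurable _ _ T1 _ _ (fun w => h t w).
Proof. apply: (@mx_measurable_gradf _ _ _ T1 f C2f); exact: past_iterate_measurable. Qed.

Lemma past_lookahead_measurable : @mx_measurable _ _ T1 _ _ (U t).
Proof.
exact: (@lookahead_inv_measurable _ _ _ T1 H K eps beta eta x0 f Sigma aK HK eps_gt0 beta01
  psdS C2f G t past_oracle_measurable).
Qed.

(** The iterate is read on the copy of the past and the new function on the copy of the present; the
    diagonal gives back [g_t]. *)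
Lemma joint_grad_measurable :
  mx_measurable (fun p : T1 * T2 => grad (F t p.2) (x t p.1)).
Proof.
apply: (@mx_measurable_grad _ _ (T1 * T2)%type d (fun p => F t p.2)).
- move=> y; apply: (@measurableT_comp _ _ _ _ _ _ (fun w : T2 => F t w y)) => //.
  by move=> _ B mB; rewrite setTI; apply: sub_sigma_algebra; exists y, B.
- by move=> p y; exact: dF.
- by move=> i j; apply: (@measurableT_comp _ _ _ _ _ _ (fun w : T1 => x t w i j)) => //;
    exact: past_iterate_measurable.
Qed.

Lemma joint_past_grad_measurable :
  mx_measurable (fun p : T1 * T2 => grad f (x t p.1)).
Proof.
by move=> i j; apply: (@measurableT_comp _ _ _ _ _ _ (fun w : T1 => h t w i j)) => //;
    exact: past_grad_measurable.
Qed.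

Lemma past_indep A B : <<s past_events F t >> A -> <<s rfun_events F t >> B ->
  P (A `&` B) = (P A * P B)%E.
Proof. exact: (@past_independent _ _ _ P _ F T mF indF t A B tT). Qed.

Let mA := past_events_measurable mF (ltnW tT).
Let mB := rfun_events_measurable mF tT.

(** Freezing yields a null set for each test vector [z]; integer vectors are countably many and
    suffice, by scaling and density. *)
Lemma ae_freezing (M : T1 * T2 -> 'M[R]_d) : mx_measurable M ->
  (forall w1, {ae P, forall w2, forall z, 0 <= qform (M (w1, w2)) z}) ->
  {ae P, forall w, forall z, 0 <= qform (M (w, w)) z}.
Proof.
move=> mM M0.
have mq z : measurable_fun setT (fun p => qform (M p) z).
  have : mx_measurable (fun p : T1 * T2 => z *m M p *m z^T).
    by apply: mx_measurableM; [apply: mx_measurableM|]; do ?exact: mx_measurable_cst.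
  by move=> /(_ 0 0).
have null z : P [set w | qform (M (w, w)) z < 0] = 0%E.
  have mN : measurable [set p | qform (M p) z < 0].
    rewrite (_ : [set p | _] = (fun p => qform (M p) z) @^-1` [set` `]-oo, 0[%R]).
      by rewrite -[X in measurable X]setTI; exact: mq.
    by apply/seteqP; split => p /=; rewrite in_itv.
  apply: (freezing_null mA mB past_indep mN) => w1.
  apply/negligibleP.
    have := @measurable_to_right _ _ _ mB; move=> mr.
    have m2 : measurable_fun setT (fun w2 : T2 => qform (M (w1, w2)) z).
      exact: (@measurableT_comp _ _ _ _ _ _ (fun p => qform (M p) z)).
    rewrite (_ : [set w2 | _] = to_right (rfun_events F t) @^-1`
      ((fun w2 : T2 => qform (M (w1, w2)) z) @^-1` [set` `]-oo, 0[%R])).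
      rewrite -[X in measurable X]setTI; apply: mr => //.
      by rewrite -[X in measurable X]setTI; exact: m2.
    by apply/seteqP; split => p /=; rewrite in_itv.
  have [N [mN' N0 sub]] := M0 w1; exists N; split => // w2 /= neg.
  apply: sub => /= /(_ z); rewrite leNgt; move/negP; exact.
have nn : {ae P, forall w, forall n : nat, if @unpickle 'rV[int]_d n is Some z
    then 0 <= qform (M (w, w)) (map_mx intr z) else true}.
  apply: ae_foralln => n; case: unpickle => [z|]; last exact: aeW.
  exists [set w | qform (M (w, w)) (map_mx intr z) < 0]; split => //.
    rewrite (_ : [set w | _] = diag_pair (past_events F t) (rfun_events F t) @^-1`
      ((fun p => qform (M p) (map_mx intr z)) @^-1` [set` `]-oo, 0[%R])).
      rewrite -[X in measurable X]setTI.
      apply: (measurable_diag_pair mA mB) => //.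
      by rewrite -[X in measurable X]setTI; exact: mq.
    by apply/seteqP; split => p /=; rewrite in_itv.
    exact: null.
  by move=> w /=; move/negP; rewrite -ltNge.
apply: ae_impl nn => w nw; apply: qform_ge0_int => z.
by have := nw (pickle z); rewrite pickleK.
Qed.

(** Passes from the noise bound at each deterministic point to the same bound at the random
    iterate. *)
Lemma ae_bounded_noise :
  {ae P, forall w, bounded_noise H eps beta eta x0 f Sigma (G w) t}.
Proof.
have mh := joint_past_grad_measurable; have mg := joint_grad_measurable.
have mout (X : T1 * T2 -> 'rV[R]_d) : mx_measurable X -> mx_measurable (fun p => (X p)^T *m X p).
  by move=> mX; apply: mx_measurableM => //; exact: mx_measurable_tr.
pose D (p : T1 * T2) := (grad f (x t p.1))^T *m grad f (x t p.1)
   - (grad (F t p.2) (x t p.1))^T *m grad (F t p.2) (x t p.1).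
have mD : mx_measurable D.
  by apply: mx_measurableD; [exact: mout|apply: mx_measurableN; exact: mout].
have A1 : {ae P, forall w, forall z, 0 <= qform (D (w, w) + Sigma) z}.
  apply: (ae_freezing (M := fun p => D p + Sigma)).
    by apply: mx_measurableD => //; exact: mx_measurable_cst.
  move=> w1; have := noiseF tT (x t w1); apply: filterS => w2 [[_ q] _] z.
  by have := q z; rewrite opprK.
have A2 : {ae P, forall w, forall z, 0 <= qform (Sigma - D (w, w)) z}.
  apply: (ae_freezing (M := fun p => Sigma - D p)).
    by apply: mx_measurableD; [exact: mx_measurable_cst|exact: mx_measurableN].
  by move=> w1; have := noiseF tT (x t w1); apply: filterS => w2 [_ [_ q]] z.
apply: ae_impl (ae_and A1 A2) => w [q1 q2] y z.
have := q1 z; have := q2 z; rewrite /D /= !qformD !qformN !qformD !qformN.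
by rewrite -[x t w]/y -[grad (F t w) y]/(G w t y) => *; split; lra.
Qed.

Lemma grad_iterate_bounded i : exists B, forall w, `|h t w 0 i| <= B.
Proof.
have [C xC] := iterate_bounded t.
have [_ dp _] := C2f.
have [B hB] := @continuous_rV_bounded R d (partial i f) C
  (fun y => differentiable_continuous (dp i y)).
by exists B => w; rewrite mxE; exact: hB.
Qed.

(** The coordinates of a vector determined by the past, so that freezing is applied to scalar
    products only. *)
Definition weight w i : R := (h t w *m U t w) 0 i.

Lemma weight_bounded w i : `|weight w i| <= Num.sqrt d%:R.
Proof.
rewrite -sqrtr_sqr ler_wsqrtr//.
apply: le_trans (@lookahead_step_bounded _ _ H K eps beta eta x0 f Sigma aK HK eps_gt0 beta01 psdS (G w) t).
 rewrite /sqnorm (bigD1 i)//= lerDl sumr_ge0// => j _; exact: sqr_ge0.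
Qed.

Lemma grad_oracle_ae_bounded i : exists B, {ae P, forall w, `|g t w 0 i| <= B}.
Proof.
have [B hB] := grad_iterate_bounded i.
(* The noise bound on the [i]-th basis vector: the squared coordinate of [g_t] exceeds that of
   [grad f] by at most [Sigma i i]. *)
exists (Num.sqrt (B ^+ 2 + Sigma i i)).
have := ae_bounded_noise; apply: filterS => w nz.
rewrite -sqrtr_sqr ler_wsqrtr//.
have [+ _] := nz (delta_mx 0 i).
rewrite !qform_outer -[qform Sigma _]/(bform Sigma _ _) bform_delta.
rewrite -!rowE !mxE => /le_trans; apply.
rewrite lerD2r -[leLHS]real_normK ?num_real// ler_pXn2r ?nnegrE//; last exact: le_trans (hB w).
by have := hB w; rewrite mxE.
Qed.

Lemma weighted_noise_mean i :
  [/\ integrableR P (fun w => weight w i * g t w 0 i),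
      integrableR P (fun w => weight w i * h t w 0 i) &
      EE (fun w => weight w i * g t w 0 i) = EE (fun w => weight w i * h t w 0 i)].
Proof.
have [Bh hB] := grad_iterate_bounded i; have [Bg gB] := grad_oracle_ae_bounded i.
have mh := grad_iterate_measurable (ltnW tT).
have mg : mx_measurable (fun w => g t w).
  by apply: (oracle_measurable tT); exact: iterate_measurable (ltnW tT).
have mU := lookahead_measurable (ltnW tT).
have mw : measurable_fun setT (fun w => weight w i) by exact: (mx_measurableM mh mU).
have iwg : integrableR P (fun w => weight w i * g t w 0 i).
  apply: (ae_bounded_integrableR (C := Num.sqrt d%:R * Bg)).
    by apply: measurable_funM => //; exact: mg.
  move: gB; apply: filterS => w gB; rewrite normrM.
  by apply: ler_pM => //; exact: weight_bounded.
have iwh : integrableR P (fun w => weight w i * h t w 0 i).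
  apply: (ae_bounded_integrableR (C := Num.sqrt d%:R * Bh)).
    by apply: measurable_funM => //; exact: mh.
  by apply: aeW => w; rewrite normrM; apply: ler_pM => //; exact: weight_bounded.
split; [exact iwg|exact iwh|rewrite /Rintegral; apply: congr1].
apply: (@freezing_integral _ _ _ P _ _ mA mB past_indep (fun w => weight w i)
  (fun w => h t w 0 i) (fun p => grad (F t p.2) (x t p.1) 0 i)); [| | |exact iwg|exact iwh|].
- exact: (@mx_measurableM _ _ T1 _ _ _ _ _ past_grad_measurable past_lookahead_measurable).
- exact: past_grad_measurable.
- exact: joint_grad_measurable.
- by move=> w1; exact (meanF tT (x t w1) i).
Qed.

Lemma stationarity_sum w : r t w = \sum_i weight w i * h t w 0 i.
Proof. by rewrite -dotE. Qed.

Lemma stationarity_integrable : integrableR P (r t).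
Proof.
rewrite (_ : r t = fun w => \sum_i weight w i * h t w 0 i).
  by apply: integrableR_sum => i; have [] := weighted_noise_mean i.
by apply/funext => w; exact: stationarity_sum.
Qed.

Lemma lookahead_noise_mean :
  integrableR P (fun w => bform (U t w) (h t w) (g t w)) /\
  EE (fun w => bform (U t w) (h t w) (g t w)) = EE (r t).
Proof.
have -> : (fun w => bform (U t w) (h t w) (g t w)) = fun w => \sum_i weight w i * g t w 0 i.
  by apply/funext => w; rewrite -dotE.
have -> : r t = fun w => \sum_i weight w i * h t w 0 i.
  by apply/funext => w; exact: stationarity_sum.
split; first by apply: integrableR_sum => i; have [] := weighted_noise_mean i.
rewrite !EE_sum => [|i|i]; try by have [] := weighted_noise_mean i.
by apply: eq_bigr => i _; have [] := weighted_noise_mean i.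
Qed.

End Past.

Local Notation S w := (\sum_(t < T) ada_S_term H eps beta eta x0 (G w) t).
Hypothesis iS : forall i j : 'I_d, integrableR P (fun w => S w i j).
Definition S_mean : 'M[R]_d := \matrix_(i, j) EE (fun w => S w i j).
Definition total_stationarity w := \sum_(t < T) r t w.
Local Notation rho := total_stationarity.

Lemma total_stationarity_integrable : integrableR P rho.
Proof. by apply: integrableR_sum => t; exact: stationarity_integrable. Qed.

Lemma tr_S_mean (A : 'M[R]_d) : integrableR P (fun w => \tr (A *m S w)) /\
  EE (fun w => \tr (A *m S w)) = \tr (A *m S_mean).
Proof.
have -> : (fun w => \tr (A *m S w)) = fun w => \sum_i \sum_j A i j * S w j i.
  by apply/funext => w; apply: eq_bigr => i _; rewrite mxE.
have i1 i j : integrableR P (fun w => A i j * S w j i) by apply: integrableRZ; exact: iS.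
have i2 i : integrableR P (fun w => \sum_j A i j * S w j i) by exact: integrableR_sum.
split; first exact: integrableR_sum.
rewrite EE_sum//; apply: eq_bigr => i _; rewrite EE_sum// mxE; apply: eq_bigr => j _.
by rewrite EE_Z ?mxE.
Qed.

Lemma all_bounded_noise : {ae P, forall w, forall t, (t < T)%N ->
  bounded_noise H eps beta eta x0 f Sigma (G w) t}.
Proof.
apply: ae_foralln => t; case: (ltnP t T) => [tT|_]; last exact: aeW.
by have := ae_bounded_noise tT; apply: filterS.
Qed.

Lemma expected_stationarity_le (A : 'M[R]_d) m : H A ->
  (forall y, loewner (hessian f y) A) -> (forall y, m <= f y) ->
  EE rho <= 2 * (f x0 - m) / eta + eta * \tr A * opnorm S_mean
    + Num.sqrt 2 * d%:R * Num.sqrt (opnorm Sigma) * opnorm S_mean.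
Proof.
move=> HA fA mf.
pose Z t w := bform (U t w) (h t w) (g t w) - 2^-1 * r t w.
have iZ (t : 'I_T) : integrableR P (Z t).
  apply: integrableRB; first by have [] := lookahead_noise_mean (ltn_ord t).
  by apply: integrableRZ; exact: stationarity_integrable.
(* The averaged cross term equals the mean of [r t], and half of it was spent in Young's inequality;
   doubling the descent bound turns [2^-1] into the constants of [xi]. *)
have EZ : EE (fun w => \sum_(t < T) Z t w) = EE rho / 2.
  rewrite EE_sum// EE_sum; last by move=> t; exact: stationarity_integrable.
  rewrite mulr_suml; apply: eq_bigr => t _.
  have [ig Eg] := lookahead_noise_mean (ltn_ord t).
  have ir := stationarity_integrable (ltn_ord t).
  rewrite /Z (EE_B ig (integrableRZ _ ir)) (EE_Z _ ir) Eg.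
  by move: (EE (r t)) => ?; field.
set c := Num.sqrt (2 * opnorm Sigma) / 2.
have [iA EA] := tr_S_mean A; have [i1 E1] := tr_S_mean 1%:M.
have le_ae : {ae P, forall w, \sum_(t < T) Z t w <=
   (f x0 - m) / eta + eta / 2 * \tr (A *m S w) + c * \tr (1%:M *m S w)}.
  have := all_bounded_noise; apply: filterS => w noise.
  have := @ada_descent_sum _ _ H K eps beta eta x0 f Sigma aK HK eps_gt0 beta01 eta_gt0 psdS
    (G w) A m T HA C2f fA mf noise.
  rewrite mul1mx; apply: le_trans; apply: ler_sum => t _.
  by rewrite /Z lerD2l lerN2 mulrC.
have iC : integrableR P (fun=> (f x0 - m) / eta) by exact: integrableR_cst.
have iA' : integrableR P (fun w => eta / 2 * \tr (A *m S w)) by exact: integrableRZ.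
have i1' : integrableR P (fun w => c * \tr (1%:M *m S w)) by exact: integrableRZ.
have := ae_le_EE (integrableR_sum _ iZ) (integrableRD (integrableRD iC iA') i1') le_ae.
rewrite EZ EE_D//; last exact: integrableRD.
rewrite EE_D// Rintegral_cst_prob !EE_Z// EA E1 => main.
have pA : psd A by move: HA; rewrite HK => -[].
have bA := tr_le_opnorm S_mean pA.
have b1 := tr_le_opnorm S_mean (psd_scalar ler01); rewrite mxtrace1 in b1.
have c0 : 0 <= c by rewrite divr_ge0 ?sqrtr_ge0.
have cE : c = Num.sqrt 2 * Num.sqrt (opnorm Sigma) / 2 by rewrite /c sqrtrM.
have e0 : 0 <= eta / 2 by rewrite divr_ge0 ?(ltW eta_gt0).
have h1 := ler_wpM2l e0 bA; have h2 := ler_wpM2l c0 b1.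
have -> : 2 * (f x0 - m) / eta + eta * \tr A * opnorm S_mean
    + Num.sqrt 2 * d%:R * Num.sqrt (opnorm Sigma) * opnorm S_mean
   = 2 * ((f x0 - m) / eta + eta / 2 * (\tr A * opnorm S_mean) + c * (d%:R * opnorm S_mean)).
  by rewrite cE; field; rewrite gt_eqF.
lra.
Qed.

Lemma expected_stationarity_le_inf : (exists m : R, forall y, m <= f y) ->
  adaptive_smoothness_finite H f ->
  EE rho <= 2 * (f x0 - inf (range f)) / eta
    + eta * adaptive_smoothness H f * opnorm S_mean
    + Num.sqrt 2 * d%:R * Num.sqrt (opnorm Sigma) * opnorm S_mean.
Proof.
move=> [m mf] [A0 [HA0 fA0]].
have lbf y : inf (range f) <= f y.
  apply: ge_inf; last by exists y.
  by exists m => _ [z _ <-].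
set a := 2 * (f x0 - inf (range f)) / eta.
set b := Num.sqrt 2 * d%:R * Num.sqrt (opnorm Sigma) * opnorm S_mean.
have main A : H A -> (forall y, loewner (- A) (hessian f y) /\ loewner (hessian f y) A) ->
    EE rho <= a + eta * \tr A * opnorm S_mean + b.
  by move=> HA fA; apply: expected_stationarity_le => // y; have [] := fA y.
set k := eta * opnorm S_mean.
have k0 : 0 <= k by rewrite mulr_ge0 ?opnorm_ge0 ?(ltW eta_gt0).
have kE y : eta * y * opnorm S_mean = k * y by rewrite /k mulrAC.
(* Passing to the infimum divides by [k]; if [k = 0] the trace term is absent and any admissible
   matrix will do. *)
rewrite kE; move: k0; rewrite le_eqVlt => /predU1P[k0|k_gt0].
  by have := main A0 HA0 fA0; rewrite kE -k0 !mul0r.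
rewrite -lerBlDr -lerBlDl mulrC -ler_pdivrMr//.
apply: lb_le_inf; first by exists (\tr A0); exists A0.
move=> _ [A /= [HA fA] <-]; rewrite ler_pdivrMr// mulrC lerBlDl lerBlDr -kE.
exact: main.
Qed.

End StochasticAnalysis.

(* Jensen's inequality for the square root enters through its tangent lines
   [sqrt x <= (x / s + s) / 2]; this is the infimum over [s]. *)
Lemma le_addM_sqrt (R : realType) (y A b xi : R) : 0 <= b -> 0 <= xi ->
  (forall s, 0 < s -> y <= A + b * ((xi / s + s) / 2)) -> y <= A + b * Num.sqrt xi.
Proof.
move=> b0; rewrite le_eqVlt => /predU1P[<-|xi0] H.
  rewrite sqrtr0 mulr0 addr0; apply/ler_addgt0Pr => e e0.
  have b1 : 0 < b + 1 by rewrite ltr_wpDl.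
  apply: (le_trans (H (2 * e / (b + 1)) _)); first by rewrite !mulr_gt0 ?invr_gt0.
  rewrite lerD2l mul0r add0r.
  have -> : b * (2 * e / (b + 1) / 2) = e * (b / (b + 1)) by field; rewrite gt_eqF.
  by rewrite ler_piMr ?(ltW e0)// ler_pdivrMr// mul1r lerDl.
have s0 : 0 < Num.sqrt xi by rewrite sqrtr_gt0.
apply: (le_trans (H _ s0)); rewrite lerD2l ler_wpM2l//.
have -> : xi / Num.sqrt xi = Num.sqrt xi.
  by rewrite -{1}(sqr_sqrtr (ltW xi0)) expr2 mulfK// gt_eqF.
lra.
Qed.

Lemma sqrtr_le_young (R : rcfType) (x s : R) : 0 <= x -> 0 < s ->
  Num.sqrt x <= (x / s + s) / 2.
Proof.
move=> x0 s0; have := sqr_ge0 (Num.sqrt x - s).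
rewrite sqrrB sqr_sqrtr// => H.
rewrite ler_pdivlMr// -(ler_pM2r s0) mulrDl divfK ?gt_eqF//.
by lra.
Qed.

Lemma powR_half_expr (R : realType) (b : R) (i : nat) : 0 <= b ->
  b `^ (i%:R / 2) = Num.sqrt b ^+ i.
Proof.
by move=> b0; rewrite mulrC powRrM powR12_sqrt// powR_mulrn// sqrtr_ge0.
Qed.

Lemma div_sqrtM (R : rcfType) (p : R) (T : nat) : 0 <= p ->
  T%:R^-1 * Num.sqrt (T%:R * p) = Num.sqrt p / Num.sqrt T%:R.
Proof.
move=> p0; rewrite sqrtrM ?ler0n// mulrA mulrC; congr (_ * _).
case: T => [|T]; first by rewrite sqrtr0 mulr0 invr0.
have T0 : 0 < T.+1%:R :> R by rewrite ltr0n.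
have s0 : Num.sqrt T.+1%:R != 0 :> R by rewrite gt_eqF// sqrtr_gt0.
by rewrite -{1}(sqr_sqrtr (ltW T0)) expr2 invfM -mulrA mulVf// mulr1.
Qed.

Theorem theorem3p1 (R : realType) (d : nat)
    (dd : measure_display) (Omega : measurableType dd) (P : probability Omega R)
    (H : set 'M[R]_d) (eps beta eta : R) (T : nat)
    (f : 'rV[R]_d -> R) (x0 : 'rV[R]_d)
    (F : nat -> Omega -> 'rV[R]_d -> R) (Sigma : 'M[R]_d) :
  well_structured H -> 0 < eps -> 0 < beta <= 1 -> 0 < eta ->
  C2 f -> (exists m : R, forall x, m <= f x) -> adaptive_smoothness_finite H f ->
  (* f_0, ..., f_{T-1} : mutually independent random differentiable functions *)
  (forall t, (t < T)%N -> forall w x, differentiable (F t w) x) ->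
  (forall t, (t < T)%N -> forall x, measurable_fun setT (fun w => F t w x)) ->
  mutually_independent P (fun t => rfun_sigma (F t)) T ->
  psd Sigma ->
  (* E[grad f_t(x)] = grad f(x) *)
  (forall t, (t < T)%N -> forall x (i : 'I_d),
      P.-integrable setT (fun w => (grad (F t w) x 0 i)%:E) /\
      (\int[P]_w (grad (F t w) x 0 i)%:E = (grad f x 0 i)%:E)%E) ->
  (* a.s. -Sigma <= grad f grad f^T - grad f_t grad f_t^T <= Sigma *)
  (forall t, (t < T)%N -> forall x,
      {ae P, forall w,
        loewner (- Sigma) ((grad f x)^T *m grad f x - (grad (F t w) x)^T *m grad (F t w) x) /\
        loewner ((grad f x)^T *m grad f x - (grad (F t w) x)^T *m grad (F t w) x) Sigma}) ->
  (* the expectation defining S_T exists *)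
  (forall i j : 'I_d, P.-integrable setT (fun w =>
      ((\sum_(t < T) ada_S_term H eps beta eta x0 (fun s x => grad (F s w) x) t) i j)%:E)) ->
  let Delta0 := f x0 - inf (range f) in
  let S_T : 'M[R]_d := \matrix_(i, j) Rintegral P setT (fun w =>
      (\sum_(t < T) ada_S_term H eps beta eta x0 (fun s x => grad (F s w) x) t) i j) in
  let xi := 2 * Delta0 / eta + eta * adaptive_smoothness H f * opnorm S_T
            + Num.sqrt 2 * d%:R * Num.sqrt (opnorm Sigma) * opnorm S_T in
  (\int[P]_w ((T%:R)^-1 * \sum_(t < T)
       Hdualnorm H (grad f (ada_x H eps beta eta x0 (fun s x => grad (F s w) x) t)))%:E
   <= (Num.sqrt (\sum_(i < T) beta `^ (i%:R / 2)) / T%:R * xi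
       + Num.sqrt (\tr (PH H ((\sum_(i < T) beta ^+ i) *: Sigma + eps%:M)))
         / Num.sqrt T%:R * Num.sqrt xi)%:E)%E.
Proof.
move=> [K [KZ KD KM K1 HK]] eps0 beta01 eta0 C2f fbelow fsmooth dF mF indF psdS meanF noiseF iS.
cbv zeta; set S_T := \matrix_(i, j) _; set xi := (2 * _ / eta + _ + _).
have aK : matrix_algebra K by [].
have b0 : 0 <= beta by case/andP: beta01 => /ltW.
pose rho := total_stationarity H eps beta eta T f x0 F Sigma.
have irho : integrableR P rho.
  exact (total_stationarity_integrable x0 aK HK eps0 beta01 eta0 C2f dF mF indF psdS meanF noiseF).
have rho0 w : 0 <= rho w.
  apply: sumr_ge0 => t _.
  exact: (@stationarity_ge0 _ _ H K eps beta eta x0 f Sigma aK HK eps0 beta01 psdS).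
have Erho : Rintegral P setT rho <= xi.
  exact (expected_stationarity_le_inf aK HK eps0 beta01 eta0 C2f dF mF indF psdS meanF noiseF iS
    fbelow fsmooth).
(* The sign of [xi] is inherited from the expectation that it bounds. *)
have xi0 : 0 <= xi by apply: le_trans Erho; apply: Rintegral_ge0 => w _; exact: rho0.
set c := \sum_(i < T) beta `^ (i%:R / 2).
have cE : c = \sum_(i < T) Num.sqrt beta ^+ i.
  by apply: eq_bigr => i _; rewrite powR_half_expr.
set p := \tr (PH H _).
have p0 : 0 <= p.
  apply/psd_tr_ge0/pd_psd.
  have [] // := @PH_sqrt _ _ H K eps aK HK eps0 ((\sum_(i < T) beta ^+ i) *: Sigma) _ => z.
  by rewrite qformZ mulr_ge0 ?psdS.2// sumr_ge0// => i _; exact: exprn_ge0.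
pose a := Num.sqrt c / T%:R; pose b := Num.sqrt p / Num.sqrt T%:R.
have a_ge0 : 0 <= a by rewrite divr_ge0 ?sqrtr_ge0.
have b_ge0 : 0 <= b by rewrite divr_ge0 ?sqrtr_ge0.
pose N w := T%:R^-1 * \sum_(t < T)
   Hdualnorm H (grad f (ada_x H eps beta eta x0 (grad_oracle F w) t)).
have N0 w : 0 <= N w.
  by rewrite mulr_ge0 ?invr_ge0// sumr_ge0// => t _; exact: Hdualnorm_ge0 HK aK.
have mN : measurable_fun setT N.
  apply: measurable_funM => //; apply: measurable_sum => t.
  apply: (continuous_mx_measurable (phi := Hdualnorm H)); last first.
    by move=> w; exact: (continuous_Hdualnorm HK aK).
  exact: (@grad_iterate_measurable _ _ _ _ H K eps beta eta T f x0 F aK HK eps0 beta01 C2f dF mF t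
    (ltnW (ltn_ord t))).
have N_le : {ae P, forall w, N w <= a * rho w + b * Num.sqrt (rho w)}.
  have := @all_bounded_noise _ _ _ _ P H K eps beta eta T f x0 F Sigma aK HK eps0 beta01 C2f
    dF mF indF noiseF.
  apply: ae_impl => w noise.
  have := @Hdualnorm_sum _ _ H K eps beta eta x0 f Sigma aK HK eps0 beta01 psdS (grad_oracle F w) T noise.
  rewrite -cE -/p => le_sum.
  have Ti : 0 <= T%:R^-1 :> R by rewrite invr_ge0.
  apply: (le_trans (ler_wpM2l Ti le_sum)).
  by rewrite mulrDr !mulrA (div_sqrtM T p0) [_^-1 * _]mulrC.
have N_young s : 0 < s -> {ae P, forall w, N w <= a * rho w + b * ((rho w / s + s) / 2)}.
  move=> s0; apply: ae_impl N_le => w /le_trans; apply.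
  by rewrite lerD2l ler_wpM2l// sqrtr_le_young.
have iY s : integrableR P (fun w => a * rho w + b * ((rho w / s + s) / 2)).
  rewrite (_ : (fun w => _) = fun w => (a + b / s / 2) * rho w + b * s / 2).
    by apply: integrableRD; [exact: integrableRZ|exact: integrableR_cst].
  by apply/funext => w; ring.
have iN : integrableR P N.
  (* The tangent line at [s = 1], affine in [rho], is an integrable majorant. *)
  apply: (ae_dominated_integrableR mN (iY 1)).
  by apply: ae_impl (N_young 1 ltr01) => w; rewrite ger0_norm.
rewrite [leLHS](_ : _ = (Rintegral P setT N)%:E); last exact: integral_EE.
rewrite lee_fin -/a -/b; apply: le_addM_sqrt => // s s0.
apply: (le_trans (ae_le_EE iN (iY s) (N_young s s0))).
rewrite (_ : (fun w => _) = fun w => (a + b / s / 2) * rho w + b * s / 2); last first.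
  by apply/funext => w; ring.
rewrite EE_D; [|exact: integrableRZ|exact: integrableR_cst].
rewrite EE_Z// Rintegral_cst_prob.
have -> : a * xi + b * ((xi / s + s) / 2) = (a + b / s / 2) * xi + b * s / 2 by ring.
rewrite lerD2r ler_wpM2l// addr_ge0// !mulr_ge0 ?invr_ge0 ?(ltW s0)//.
Qed.
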